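(* Let $\mathscr{H}$ be a complex Hilbert space, let $\mathbf{A}=(A_1,\dots,A_n)$ and $\mathbf{B}=(B_1,\dots,B_n)$ be finite sequences of strictly positive operators on $\mathscr{H}$ with $\sum_{j=1}^n A_j=\sum_{j=1}^n B_j=I$, and let $f:(0,\infty)\to[0,\infty)$ be an operator monotone function that is operator concave. Then: (1) for all $p\in[0,1]$ and for any fixed real number $t_0>0$, $$f\left[\sum_{j=1}^n(A_j\natural_{p+1}B_j)+t_0\left(I-\sum_{j=1}^nA_j\natural_pB_j\right)\right]-f(t_0)\left(I-\sum_{j=1}^nA_j\natural_pB_j\right)\ \ge\ S_p^f(\mathbf{A}|\mathbf{B});$$ (2) for all $p\in[2,3]$ and for any fixed real number $t_0>0$, $$-f\left[\sum_{j=1}^n(A_j\natural_{p-1}B_j)+t_0\left(I-\sum_{j=1}^nA_j\natural_pB_j\right)\right]+f(t_0)\left(I-\sum_{j=1}^nA_j\natural_pB_j\right)\ \le\ S_p^f(\mathbf{A}|\mathbf{B}).$$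
   Context: $\mathbb{B}(\mathscr{H})$ is the algebra of bounded linear operators on $\mathscr{H}$ and $I$ is the identity. A self-adjoint $A\in\mathbb{B}(\mathscr{H})$ is positive ($A\ge 0$) if $\langle Ax,x\rangle\ge 0$ for all $x\in\mathscr{H}$, and strictly positive ($A>0$) if it is positive and invertible; for self-adjoint $A,B$, $A\le B$ means $B-A\ge 0$. Functions are applied to self-adjoint operators by continuous functional calculus. A continuous real function $f$ on an interval $J$ is operator monotone if $A\le B$ implies $f(A)\le f(B)$ for all self-adjoint $A,B\in\mathbb{B}(\mathscr{H})$ with spectra in $J$. It is operator concave on $J$ if $\lambda f(A)+(1-\lambda)f(B)\le f(\lambda A+(1-\lambda)B)$ for all self-adjoint $A,B\in\mathbb{B}(\mathscr{H})$ with spectra in $J$ and all $\lambda\in[0,1]$. For strictly positive $X,Y$ and $q\in\mathbb{R}$, $X\natural_qY:=X^{1/2}\left(X^{-1/2}YX^{-1/2}\right)^qX^{1/2}$. For strictly positive $A,B$ and $q\in\mathbb{R}$, $S_q^f(A|B):=A^{1/2}\left(A^{-1/2}BA^{-1/2}\right)^q f\left(A^{-1/2}BA^{-1/2}\right)A^{1/2}$, and $S_q^f(\mathbf{A}|\mathbf{B}):=\sum_{j=1}^n S_q^f(A_j|B_j)$ (the generalized operator Shannon entropy).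
   Formalization: In part (2) the operator inside f[...] is additionally assumed to have its spectrum in (0,∞), since f is defined only there and this can fail (e.g. H = C, A = (1/2,1/2), B = (9/10,1/10), p = 2, t_0 = 2 gives −0.28). *)

(* Defs.v *)
From HB Require Import structures.
From mathcomp Require Import all_boot all_order all_algebra complex.
From mathcomp Require Import boolp classical_sets functions set_interval reals.
From mathcomp Require Import topology normedtype exp.

Set Implicit Arguments.
Unset Strict Implicit.
Unset Printing Implicit Defensive.

Import Order.TTheory GRing.Theory Num.Theory.
Import numFieldNormedType.Exports.

Local Open Scope classical_set_scope.
Local Open Scope ring_scope.
Local Open Scope complex_scope.

(* The norm and the inner product take values in R[i], where 0 <= z means that
   z is real and nonnegative. The inner product is linear in its first argument
   and conjugate-linear in its second one. *)
HB.mixin Record isHilbert (R : realType) H & CompleteNormedModule R[i] H := {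
  inner : {dot H for Num.conj};
  sqr_normE : forall x : H, `|x| ^+ 2 = inner x x
}.

#[short(type="hilbertType")]
HB.structure Definition Hilbert (R : realType) :=
  {H of CompleteNormedModule R[i] H & isHilbert R H}.

Section BoundedOperators.
Variables (R : realType) (H : hilbertType R).

Definition bounded_op : {pred H -> H} := [pred T : H -> H |
  `[< linear T /\ exists M : R, forall x, `|T x| <= M%:C * `|x| >]].

Record bop := Bop { bop_fun :> H -> H; bop_funP : bop_fun \in bounded_op }.

HB.instance Definition _ := [isSub for bop_fun].
HB.instance Definition _ := [Choice of bop by <:].

Lemma bounded_opP (T : H -> H) :
  reflect (linear T /\ exists M : R, forall x, `|T x| <= M%:C * `|x|)
          (T \in bounded_op).
Proof. exact: asboolP. Qed.

Lemma bounded_op_submod : submod_closed bounded_op.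
Proof.
split=> [|a S T].
  apply/bounded_opP; split=> [k x y|]; first by rewrite /= scaler0 addr0.
  by exists 0 => x; rewrite normr0 mul0r.
move=> /bounded_opP[lS [M hM]] /bounded_opP[lT [N hN]]; apply/bounded_opP.
split=> [k x y|].
  rewrite !fctE lS lT scalerDr [a *: (k *: S x)]scalerA mulrC -scalerA.
  by rewrite scalerDr addrACA.
exists (complex.Re `|a| * M + N) => x; rewrite fctE.
have aE : (complex.Re `|a|)%:C = `|a| by apply/RRe_real/ger0_real.
rewrite rmorphD rmorphM /= aE mulrDl -mulrA.
apply: (le_trans (ler_normD _ _)); apply: lerD; last exact: hN.
by rewrite normrZ ler_wpM2l.
Qed.

HB.instance Definition _ :=
  GRing.isSubmodClosed.Build R[i] (H -> H) bounded_op
    (GRing.submod_closed_semi bounded_op_submod).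
HB.instance Definition _ := [SubChoice_isSubLmodule of bop by <:].

Lemma bop1_subproof : id \in bounded_op.
Proof. by apply/bounded_opP; split=> //; exists 1 => x; rewrite mul1r. Qed.

Lemma bopM_subproof (S T : bop) : S \o T \in bounded_op.
Proof.
case: S T => [S /= /bounded_opP[lS [M hM]]] [T /= /bounded_opP[lT [N hN]]].
apply/bounded_opP; split=> [k x y|]; first by rewrite /= lT lS.
exists (`|M| * N) => x /=; apply: (le_trans (hM _)).
have h : `|T x| * M%:C <= `|T x| * `|M|%:C.
  by apply: ler_wpM2l => //; rewrite lecR ler_norm.
rewrite mulrC; apply: (le_trans h); rewrite rmorphM /= -mulrA mulrC.
by apply: ler_wpM2l => //; rewrite (@lecR _ 0) normr_ge0.
Qed.

Definition bop_one : bop := Bop bop1_subproof.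
Definition bop_mul (S T : bop) : bop := Bop (bopM_subproof S T).

Lemma bopP (S T : bop) : S =1 T -> S = T.
Proof. by move=> eST; apply/val_inj/funext. Qed.

Lemma bop_linear (T : bop) : linear T.
Proof. by case: T => T /= /bounded_opP[]. Qed.

Lemma bop_mulA : associative bop_mul. Proof. by move=> S T U; apply: bopP. Qed.
Lemma bop_mul1r : left_id bop_one bop_mul. Proof. by move=> S; apply: bopP. Qed.
Lemma bop_mulr1 : right_id bop_one bop_mul. Proof. by move=> S; apply: bopP. Qed.
Lemma bop_mulDl : left_distributive bop_mul +%R.
Proof. by move=> S T U; apply: bopP. Qed.
Lemma bop_mulDr : right_distributive bop_mul +%R.
Proof.
move=> S T U; apply: bopP => x /=.
by have := bop_linear S 1 (T x) (U x); rewrite !scale1r.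
Qed.

HB.instance Definition _ := GRing.Zmodule_isPzRing.Build bop
  bop_mulA bop_mul1r bop_mulr1 bop_mulDl bop_mulDr.

Definition bop_invertible (T : bop) : Prop := exists S : bop, S * T = 1 /\ T * S = 1.

Definition spectrum (T : bop) : set R[i] :=
  [set z | ~ bop_invertible (T - z *: (1 : bop))].

Definition spectrum_in (J : interval R) (T : bop) : Prop :=
  forall z, spectrum T z -> exists2 t : R, t \in J & z = t%:C.

Definition self_adjoint (T : bop) : Prop :=
  forall x y : H, inner (T x) y = inner x (T y).

Definition positive_op (T : bop) : Prop :=
  self_adjoint T /\ forall x : H, 0 <= inner (T x) x.

Definition strictly_positive (T : bop) : Prop := positive_op T /\ bop_invertible T.

Definition op_le (S T : bop) : Prop := positive_op (T - S).

Definition op_poly (p : {poly R}) (T : bop) : bop :=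
  \sum_(i < size p) (p`_i)%:C *: T ^+ i.

(* S is the value at f of the continuous functional calculus of the
   self-adjoint operator T: S is the limit in operator norm of p(T) as the
   polynomial p tends to f uniformly on the spectrum of T, which is real.
   The last clause says that the operator norm of p(T) - S is at most e. *)
Definition is_cfc (f : R -> R) (T S : bop) : Prop :=
  forall e : R, 0 < e -> exists p : {poly R},
    (forall t : R, spectrum T t%:C -> `|p.[t] - f t| <= e) /\
    (forall x : H, `|(op_poly p T - S) x| <= e%:C * `|x|).

(* f(T); only the values of f on the spectrum of T matter, and the default
   value 0 is taken only outside the scope of the functional calculus. *)
Definition cfc (f : R -> R) (T : bop) : bop := xget 0 [set S | is_cfc f T S].

Definition op_pow (T : bop) (q : R) : bop := cfc (fun t => t `^ q) T.

Definition op_conj (A B : bop) : bop :=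
  op_pow A (- 2^-1) * B * op_pow A (- 2^-1).

Definition natural_pow (q : R) (A B : bop) : bop :=
  op_pow A 2^-1 * op_pow (op_conj A B) q * op_pow A 2^-1.

Definition entropy (f : R -> R) (q : R) (A B : bop) : bop :=
  op_pow A 2^-1 * op_pow (op_conj A B) q * cfc f (op_conj A B) * op_pow A 2^-1.

Definition shannon_entropy (f : R -> R) (q : R) (n : nat) (A B : 'I_n -> bop) :
  bop := \sum_(j < n) entropy f q (A j) (B j).

End BoundedOperators.

(* A function on an interval J is given by a total function R -> R, of which
   only the restriction to J matters. Monotonicity and concavity are required
   in B(H) for every complex Hilbert space H. *)
Definition operator_monotone (R : realType) (J : interval R) (f : R -> R) :=
  {within [set` J], continuous f} /\
  forall (H : hilbertType R) (A B : bop H),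
    self_adjoint A -> self_adjoint B -> spectrum_in J A -> spectrum_in J B ->
    op_le A B -> op_le (cfc f A) (cfc f B).

Definition operator_concave (R : realType) (J : interval R) (f : R -> R) :=
  {within [set` J], continuous f} /\
  forall (H : hilbertType R) (A B : bop H),
    self_adjoint A -> self_adjoint B -> spectrum_in J A -> spectrum_in J B ->
    forall l : R, 0 <= l <= 1 ->
      op_le (l%:C *: cfc f A + (1 - l)%:C *: cfc f B)
            (cfc f (l%:C *: A + (1 - l)%:C *: B)).

(* Main.v *)
(* Write X_j = A_j^(-1/2) B_j A_j^(-1/2) and K = \sum_j A_j #_p B_j. The tangent
   line of t^p at t = 1 compares A_j #_p B_j with (1 - p) A_j + p B_j, and summing
   gives K <= I for p in [0, 1] and K >= I for p >= 1.

   (2) is then a comparison of signs: the left-hand side is at most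
   f(t0) (I - K) <= 0, because f >= 0, and the right-hand side is positive.

   (1) is Jensen's operator inequality
     \sum_j C_j* f(X_j) C_j <= f(\sum_j C_j* X_j C_j),  \sum_j C_j* C_j = I,
   for the weights C_j = X_j^(p/2) A_j^(1/2), whose squares C_j* C_j add up to K,
   together with the weight (I - K)^(1/2) at the scalar operator t0 I. To prove
   it, let D be the diagonal operator with entries X_j on the direct sum of copies
   of H, V the isometry x |-> (C_j x)_j and W the unitary 2 V V* - I. Concavity
   bounds (f(D) + W f(D) W) / 2 by f(M), where M = (D + W D W) / 2 satisfies
   M V = V (V* D V), hence f(M) V = V f(V* D V), and compressing by V gives the
   inequality.

   The functional calculus rests on the estimate |p(T)| <= e if |p| <= e on the
   spectrum of T, which follows from the fact that the infimum of the quadratic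
   form of a self-adjoint operator lies in its spectrum, applied to e^2 - p^2. *)
From HB Require Import structures.
Require Import Defs.
From mathcomp Require Import all_boot all_order all_algebra complex.
From mathcomp Require Import boolp classical_sets functions set_interval reals.
From mathcomp Require Import topology normedtype sequences derive realfun exp.
From mathcomp Require Import ring lra.

Set Implicit Arguments.
Unset Strict Implicit.
Unset Printing Implicit Defensive.

Import Order.TTheory GRing.Theory Num.Theory.
Import numFieldNormedType.Exports.

Local Open Scope ring_scope.
Local Open Scope complex_scope.

(** * The real inner product and bounded operators *)

Section RealInner.
Variables (R : realType) (H : hilbertType R).
Implicit Types (x y z : H) (r s : R) (T S : bop H).

(* Real parts lose no information on self-adjointness and positivity
   (self_adjointP, positive_opP), so H is treated as a real Hilbert space except
   where complex roots of polynomials enter. *)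
Definition ip x y : R := complex.Re (inner x y).
Definition nrm x : R := complex.Re `|x|.

Lemma normE x : `|x| = (nrm x)%:C.
Proof. by rewrite /nrm RRe_real// ger0_real. Qed.

Lemma nrm_ge0 x : 0 <= nrm x.
Proof. by rewrite -ler0c -normE. Qed.

Lemma innerC x y : inner x y = (inner y x)^*%C.
Proof. by rewrite (@hermitian_subproof _ _ _ _ (@inner R H)) expr0 mul1r. Qed.

Lemma innerDl x y z : inner (x + y) z = inner x z + inner y z.
Proof. exact: linearDl. Qed.

Lemma innerZl (a : R[i]) x z : inner (a *: x) z = a * inner x z.
Proof. exact: linearZl_LR. Qed.

Lemma ipC x y : ip x y = ip y x.
Proof. by rewrite /ip innerC; case: (inner y x). Qed.

Lemma ipDl x y z : ip (x + y) z = ip x z + ip y z.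
Proof. by rewrite /ip innerDl; case: (inner x z); case: (inner y z). Qed.

Lemma ipDr x y z : ip x (y + z) = ip x y + ip x z.
Proof. by rewrite !(ipC x) ipDl. Qed.

Lemma ipZl r x y : ip (r%:C *: x) y = r * ip x y.
Proof. by rewrite /ip innerZl; case: (inner x y) => a b /=; rewrite mul0r subr0. Qed.

Lemma ipZr r x y : ip x (r%:C *: y) = r * ip x y.
Proof. by rewrite ipC ipZl ipC. Qed.

Lemma ipNl x y : ip (- x) y = - ip x y.
Proof. by have := ipZl (-1) x y; rewrite rmorphN1 scaleN1r mulN1r. Qed.

Lemma ipNr x y : ip x (- y) = - ip x y.
Proof. by rewrite ipC ipNl ipC. Qed.

Lemma ipBl x y z : ip (x - y) z = ip x z - ip y z.
Proof. by rewrite ipDl ipNl. Qed.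

Lemma ipBr x y z : ip x (y - z) = ip x y - ip x z.
Proof. by rewrite ipDr ipNr. Qed.

Lemma ip0l y : ip 0 y = 0.
Proof. by have := ipZl 0 0 y; rewrite rmorph0 scale0r mul0r. Qed.

Lemma ip_suml (I : Type) (s : seq I) (F : I -> H) y :
  ip (\sum_(i <- s) F i) y = \sum_(i <- s) ip (F i) y.
Proof.
elim/big_rec2 : _ => [|i a b _ <-]; first by rewrite ip0l.
by rewrite ipDl.
Qed.

Lemma ipxx x : ip x x = nrm x ^+ 2.
Proof.
have := sqr_normE x; rewrite /ip normE -rmorphXn /= => <-.
by [].
Qed.

Lemma nrm_eq0 x : nrm x = 0 -> x = 0.
Proof. by move=> x0; apply/eqP; rewrite -normr_eq0 normE x0 rmorph0. Qed.

Lemma nrmZ (a : R[i]) x : nrm (a *: x) = complex.Re `|a| * nrm x.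
Proof.
have aR : (complex.Re `|a|)%:C = `|a| by apply/RRe_real/ger0_real.
by apply: complexI; rewrite rmorphM /= aR -!normE normrZ.
Qed.

Lemma nrmD x y : nrm (x + y) <= nrm x + nrm y.
Proof. by rewrite -lecR rmorphD /= -!normE ler_normD. Qed.

Lemma nrmN x : nrm (- x) = nrm x.
Proof. by rewrite /nrm normrN. Qed.

Lemma nrmB x y : nrm (x - y) <= nrm x + nrm y.
Proof. by rewrite (le_trans (nrmD _ _))// nrmN. Qed.

Lemma nrm_distC x y : nrm (x - y) = nrm (y - x).
Proof. by rewrite -opprB nrmN. Qed.

Lemma nrm_triangle x y z : nrm (x - z) <= nrm (x - y) + nrm (y - z).
Proof. by rewrite (le_trans _ (nrmD _ _))// addrA subrK. Qed.

Lemma nrm0 : nrm 0 = 0.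
Proof. by rewrite /nrm normr0. Qed.

Lemma bopD T S x : (T + S) x = T x + S x. Proof. by []. Qed.
Lemma bopN T x : (- T) x = - T x. Proof. by []. Qed.
Lemma bopB T S x : (T - S) x = T x - S x. Proof. by []. Qed.
Lemma bopM T S x : (T * S) x = T (S x). Proof. by []. Qed.
Lemma bopZ (a : R[i]) T x : (a *: T) x = a *: T x. Proof. by []. Qed.
Lemma bop1 x : (1 : bop H) x = x. Proof. by []. Qed.
Lemma bop0 x : (0 : bop H) x = 0. Proof. by []. Qed.

Lemma bop_sum (I : Type) (s : seq I) (F : I -> bop H) x :
  (\sum_(i <- s) F i) x = \sum_(i <- s) F i x.
Proof. by elim/big_rec2 : _ => // i a b _ <-. Qed.

Lemma bop_add T x y : T (x + y) = T x + T y.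
Proof. by have := bop_linear T 1 x y; rewrite !scale1r. Qed.

Lemma bop_at0 T : T 0 = 0.
Proof. by apply: (addrI (T 0)); rewrite -bop_add !addr0. Qed.

Lemma bop_scale T (a : R[i]) x : T (a *: x) = a *: T x.
Proof. by have := bop_linear T a x 0; rewrite !addr0 bop_at0 addr0. Qed.

Lemma bop_opp T x : T (- x) = - T x.
Proof. by rewrite -scaleN1r bop_scale scaleN1r. Qed.

Lemma bop_sub T x y : T (x - y) = T x - T y.
Proof. by rewrite bop_add bop_opp. Qed.

Lemma bop_scaleAl (a : R[i]) T S : a *: (T * S) = (a *: T) * S.
Proof. exact: bopP. Qed.

Lemma bop_scaleAr (a : R[i]) T S : a *: (T * S) = T * (a *: S).
Proof. by apply: bopP => x; rewrite bopZ !bopM bopZ bop_scale. Qed.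

Lemma bop_bounded T : exists2 M, 0 < M & forall x, nrm (T x) <= M * nrm x.
Proof.
case: T => T /= /bounded_opP [_ [M hM]]; exists (`|M| + 1); first by rewrite ltr_pwDr.
move=> x; have := hM x; rewrite !normE -rmorphM lecR => /le_trans; apply.
by rewrite ler_wpM2r ?nrm_ge0// (le_trans (ler_norm _))// lerDl.
Qed.

Lemma mkbop (f : H -> H) (M : R) :
  linear f -> (forall x, nrm (f x) <= M * nrm x) -> exists T : bop H, forall x, T x = f x.
Proof.
move=> lf hM; have fP : f \in bounded_op (H := H).
  by apply/bounded_opP; split=> //; exists M => x; rewrite !normE -rmorphM lecR.
by exists (Bop fP).
Qed.

Definition rsa T := forall x y, ip (T x) y = ip x (T y).

(** A function that commutes with multiplication by i is determined by its real part, because the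
    real part of [a ('i%C *: x)] is minus the imaginary part of [a x]. *)
Lemma eq_of_Re (a b : H -> R[i]) :
  (forall x, complex.Re (a x) = complex.Re (b x)) ->
  (forall x, a ('i%C *: x) = 'i%C * a x) -> (forall x, b ('i%C *: x) = 'i%C * b x) ->
  a =1 b.
Proof.
move=> hR ha hb x; have := hR x; have := hR ('i%C *: x); rewrite ha hb.
case: (a x) (b x) => [a1 a2] [b1 b2] /=.
by rewrite !mul0r !mul1r !add0r => /oppr_inj -> ->.
Qed.

Lemma self_adjointP T : self_adjoint T <-> rsa T.
Proof.
split=> [sT x y|sT x y]; first by rewrite /ip sT.
apply: (@eq_of_Re (fun x => inner (T x) y) (fun x => inner x (T y))) => [z|z|z].
- exact: sT.
- by rewrite bop_scale innerZl.
- by rewrite innerZl.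
Qed.

Lemma rsaD T S : rsa T -> rsa S -> rsa (T + S).
Proof. by move=> sT sS x y; rewrite !bopD ipDl ipDr sT sS. Qed.

Lemma rsaN T : rsa T -> rsa (- T).
Proof. by move=> sT x y; rewrite !bopN ipNl ipNr sT. Qed.

Lemma rsaB T S : rsa T -> rsa S -> rsa (T - S).
Proof. by move=> sT sS; apply: rsaD => //; apply: rsaN. Qed.

Lemma rsaZ r T : rsa T -> rsa (r%:C *: T).
Proof. by move=> sT x y; rewrite !bopZ ipZl ipZr sT. Qed.

Lemma rsa1 : rsa (1 : bop H). Proof. by []. Qed.

Lemma rsa_sum (I : Type) (s : seq I) (F : I -> bop H) :
  (forall i, rsa (F i)) -> rsa (\sum_(i <- s) F i).
Proof.
move=> hF; elim/big_rec : _ => [|i T _]; last exact: rsaD.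
by move=> x y; rewrite !bop0 ip0l ipC ip0l.
Qed.

Lemma positive_opP T : positive_op T <-> rsa T /\ forall x, 0 <= ip (T x) x.
Proof.
split=> [[/self_adjointP sT pT]|[sT pT]]; split=> //.
- by move=> x; have := pT x; rewrite lecE => /andP[].
- exact/self_adjointP.
move=> x; rewrite lecE pT andbT /=.
(* By symmetry [inner (T x) x] equals its own conjugate, so its imaginary part is zero. *)
have := innerC (T x) x; rewrite (proj2 (self_adjointP T) sT).
by case: (inner x (T x)) => a b [] b0; apply/eqP; move: b0 => /=; lra.
Qed.

Lemma op_leP T S : rsa T -> rsa S ->
  op_le T S <-> forall x, ip (T x) x <= ip (S x) x.
Proof.
move=> sT sS; rewrite /op_le positive_opP; split=> [[_ h] x|h].
  by rewrite -subr_ge0 -ipBl; exact: h.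
by split; [exact: rsaB|move=> x; rewrite bopB ipBl subr_ge0].
Qed.

(** The discriminant criterion. The sign of [c] is not given, so the cases where the polynomial is
    affine or opens downwards have to be refuted or reduced to [b = 0]. *)
Lemma quad_discr (a b c : R) : (forall t, 0 <= a + (b * t) *+ 2 + c * t ^+ 2) -> b ^+ 2 <= a * c.
Proof.
move=> h; have [c0|c0|c0] := ltrgt0P c; last 1 first.
- rewrite c0 mulr0; have [->|b0] := eqVneq b 0; first by rewrite expr0n.
  (* At this point the affine function takes the value -1. *)
  exfalso; have := h (- (a + 1) / (b *+ 2)); rewrite c0 mul0r addr0.
  have -> : (b * (- (a + 1) / (b *+ 2))) *+ 2 = - (a + 1) by field.
  lra.
(* The vertex of the parabola. *)
- have := h (- b / c); have -> : a + b * (- b / c) *+ 2 + c * (- b / c) ^+ 2 = (a * c - b ^+ 2) / c.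
    by field; rewrite gt_eqF.
  by rewrite pmulr_lge0 ?invr_gt0// subr_ge0.
- exfalso; have [a0|a0] := leP 0 a; last first.
    by have := h 0; rewrite mulr0 expr0n /= mulr0 mul0rn !addr0 leNgt a0.
  (* Here [u] solves c u = -(2|b| + a), which makes the value at 1 + u at most c (1 + u) - a u, a
     negative number. *)
  pose u := (`|b| *+ 2 + a) / - c.
  have cu : c * u = - (`|b| *+ 2 + a) by rewrite /u; field; rewrite lt_eqF.
  have b0 := normr_ge0 b; have b1 := ler_norm b.
  have u0 : 0 <= u by rewrite divr_ge0//; lra.
  have := h (1 + u).
  have -> : a + b * (1 + u) *+ 2 + c * (1 + u) ^+ 2 =
    a + (b * (1 + u)) *+ 2 + (1 + u) * (c + c * u) by ring.
  rewrite cu; have p1 : (b - `|b|) * (1 + u) <= 0 by nra.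
  have p2 : 0 <= a * u by nra.
  nra.
Qed.

(** Cauchy-Schwarz for the semi-inner product given by [T]: its form at x + t y is a nonnegative
    quadratic in t. *)
Lemma pos_CS T : rsa T -> (forall x, 0 <= ip (T x) x) ->
  forall x y, ip (T x) y ^+ 2 <= ip (T x) x * ip (T y) y.
Proof.
move=> sT pT x y; apply: quad_discr => t; have := pT (x + t%:C *: y).
rewrite bop_add bop_scale !(ipDl, ipDr, ipZl, ipZr) (sT y x) (ipC y (T x)).
by congr (_ <= _); ring.
Qed.

Lemma CS x y : `|ip x y| <= nrm x * nrm y.
Proof.
have := @pos_CS 1 rsa1 _ x y; rewrite !bop1 !ipxx => h.
have {}h : ip x y ^+ 2 <= nrm x ^+ 2 * nrm y ^+ 2.
  by apply: h => z; rewrite bop1 ipxx sqr_ge0.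
rewrite -ler_sqr ?nnegrE ?normr_ge0 ?mulr_ge0 ?nrm_ge0//.
by rewrite real_normK ?num_real// exprMn.
Qed.

(** A form bound gives a norm bound: [pos_CS] at the pair x, T x yields |Tx|^4 <= g |x|^2 g |Tx|^2,
    and |Tx|^2 cancels. *)
Lemma pos_opbound T g : 0 <= g -> rsa T -> (forall x, 0 <= ip (T x) x <= g * nrm x ^+ 2) ->
  forall x, nrm (T x) <= g * nrm x.
Proof.
move=> g0 sT hT x; have [p1 p2] : (0 <= ip (T x) x) /\ (ip (T x) x <= g * nrm x ^+ 2).
  by apply/andP.
have [q1 q2] : (0 <= ip (T (T x)) (T x)) /\ (ip (T (T x)) (T x) <= g * nrm (T x) ^+ 2).
  by apply/andP.
have := @pos_CS T sT (fun x => proj1 (andP (hT x))) x (T x); rewrite ipxx => h.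
have {}h : nrm (T x) ^+ 2 * nrm (T x) ^+ 2 <= (g * nrm x) ^+ 2 * nrm (T x) ^+ 2.
  rewrite -expr2 (le_trans h)// (le_trans (ler_pM p1 q1 p2 q2))//.
  by rewrite le_eqVlt; apply/orP; left; apply/eqP; ring.
have [->|n0] := eqVneq (nrm (T x)) 0; first by rewrite mulr_ge0// nrm_ge0.
rewrite -ler_sqr ?nnegrE ?nrm_ge0 ?mulr_ge0 ?nrm_ge0//.
by rewrite -(ler_pM2r (_ : 0 < nrm (T x) ^+ 2)) // exprn_gt0 // lt_neqAle eq_sym n0 nrm_ge0.
Qed.

End RealInner.

(** * Completeness of B(H) *)

Section Completeness.
Variables (R : realType) (H : hilbertType R).
Implicit Types (x y z : H) (e M : R) (T S : bop H).

Lemma hilbert_complete (u : nat -> H) :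
  (forall e, 0 < e -> exists N, forall n m, (N <= n)%N -> (N <= m)%N -> nrm (u n - u m) <= e) ->
  exists l, forall e, 0 < e -> exists N, forall n, (N <= n)%N -> nrm (u n - l) <= e.
Proof.
(* In the order of [R[i]] a positive element is real, so real tolerances suffice. *)
move=> hu; have posC (e : R[i]) : 0 < e -> e = (complex.Re e)%:C /\ 0 < complex.Re e.
  case: e => a b; rewrite ltcE /= => /andP[/eqP -> ->].
  by rewrite complexr0.
have : cauchy (u @ \oo)%classic.
  apply: cauchy_exP => e /posC[-> e0]; have [|N hN] := hu (complex.Re e / 2).
    by rewrite divr_gt0.
  exists (u N); exists N => // n /= Nn; rewrite -ball_normE /= normE ltcR.
  by rewrite (le_lt_trans (hN _ _ _ _))// ltr_pdivrMr// ltr_pMr// ltr1n.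
move=> /cauchy_cvgP /cvg_ex[l /= /cvgrPdist_le hl]; exists l => e e0.
have [|N _ hN] := hl e%:C; first by rewrite ltcR.
by exists N => n Nn; have := hN n Nn; rewrite /= normE lecR nrm_distC.
Qed.

Lemma nrm_limit_le (u : nat -> H) (l : H) c :
  (forall e, 0 < e -> exists N, forall n, (N <= n)%N -> nrm (u n - l) <= e) ->
  (exists N, forall n, (N <= n)%N -> nrm (u n) <= c) -> nrm l <= c.
Proof.
move=> hl [N hN]; apply/ler_addgt0Pr => e /hl[N' hN'].
have := hN _ (leq_maxl N N'); have := hN' _ (leq_maxr N N').
move: (maxn N N') => n h1 h2.
have := nrm_triangle l (u n) 0; rewrite !subr0 nrm_distC; lra.
Qed.

(** The candidate is the pointwise limit; letting m tend to infinity in the uniform Cauchy estimate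
    gives convergence in operator norm. *)
Lemma bop_complete (T : nat -> bop H) :
  (forall e, 0 < e -> exists N, forall n m, (N <= n)%N -> (N <= m)%N ->
     forall x, nrm ((T n - T m) x) <= e * nrm x) ->
  exists S : bop H, forall e, 0 < e -> exists N, forall n, (N <= n)%N ->
     forall x, nrm ((T n - S) x) <= e * nrm x.
Proof.
move=> hT.
have hlim x : exists l, forall e, 0 < e -> exists N, forall n, (N <= n)%N -> nrm (T n x - l) <= e.
  apply: hilbert_complete => e e0.
  have k0 : 0 < nrm x + 1 by rewrite ltr_pwDr ?nrm_ge0.
  have [|N hN] := hT (e / (nrm x + 1)); first by rewrite divr_gt0.
  exists N => n m Nn Nm; apply: le_trans (hN n m Nn Nm x) _.
  rewrite mulrAC ler_pdivrMr// ler_wpM2l ?ltW//; lra.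
have [f fP] := choice hlim.
have bnd e : 0 < e -> exists N, forall n, (N <= n)%N -> forall x, nrm (T n x - f x) <= e * nrm x.
  move=> /hT[N hN]; exists N => n Nn x.
  apply: (@nrm_limit_le (fun m => T n x - T m x)).
    move=> e' /(fP x)[N' hN']; exists N' => m /hN' h.
    by rewrite opprB addrC addrA subrK nrm_distC.
  by exists N => m Nm; exact: hN.
have uniq_lim (u : nat -> H) (l l' : H) :
  (forall e, 0 < e -> exists N, forall n, (N <= n)%N -> nrm (u n - l) <= e) ->
  (forall e, 0 < e -> exists N, forall n, (N <= n)%N -> nrm (u n - l') <= e) -> l = l'.
  move=> h h'; apply/eqP; rewrite -subr_eq0; apply/eqP/nrm_eq0/le_anti.
  rewrite nrm_ge0 andbT; apply/ler_addgt0Pr => e e0; rewrite add0r.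
  apply: (@nrm_limit_le (fun n => u n - l')); last exact: h'.
  by move=> e' /h[N hN]; exists N => n /hN h2; rewrite opprB addrA subrK.
have lf : linear f.
  move=> a x y; apply: (uniq_lim (fun n => T n (a *: x + y))); first exact: fP.
  move=> e e0; have k0 : 0 < complex.Re `|a| + 1.
    by rewrite ltr_pwDr// -ler0c RRe_real// ger0_real.
  (* The denominator |a| + 1 stays positive when a = 0. *)
  have [|N hN] := fP x (e / 2 / (complex.Re `|a| + 1)); first by rewrite !divr_gt0.
  have [|N' hN'] := fP y (e / 2); first by rewrite divr_gt0.
  exists (maxn N N') => n; rewrite geq_max => /andP[/hN h1 /hN' h2].
  rewrite bop_linear opprD addrACA -scalerBr (le_trans (nrmD _ _))// nrmZ.
  move: h1; rewrite ler_pdivlMr// => h1.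
  have := nrm_ge0 (T n x - f x); nra.
(* The limit is bounded because it lies within distance 1 of a single bounded [T N]. *)
have [|N hN] := bnd 1 => //; have [M M0 hM] := bop_bounded (T N).
have [S hS] : exists S : bop H, forall x, S x = f x.
  apply: (@mkbop _ _ _ (M + 1)) => // x.
  have := hN N (leqnn N) x; have := hM x.
  have := nrm_triangle (f x) (T N x) 0; rewrite !subr0 nrm_distC mulrDl.
  lra.
exists S => e /bnd[N' hN']; exists N' => n /hN' h x.
by rewrite bopB hS.
Qed.
End Completeness.

(** * Invertibility and the spectrum of self-adjoint operators *)

Section Invertibility.
Variables (R : realType) (H : hilbertType R).
Implicit Types (x y z : H) (c e M : R) (T S : bop H).

Lemma bop_eq0_lim T : (forall e, 0 < e -> forall x, nrm (T x) <= e * nrm x) -> T = 0.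
Proof.
move=> hT; apply: bopP => x; rewrite bop0; apply/nrm_eq0/le_anti.
rewrite nrm_ge0 andbT; apply/ler_addgt0Pr => e e0; rewrite add0r.
have k0 : 0 < nrm x + 1 by rewrite ltr_pwDr ?nrm_ge0.
apply: le_trans (hT (e / (nrm x + 1)) _ x) _; first by rewrite divr_gt0.
rewrite mulrAC ler_pdivrMr// ler_wpM2l ?ltW//; lra.
Qed.

Lemma expr_lim (g : R) : 0 <= g < 1 ->
  forall e, 0 < e -> exists N, forall n, (N <= n)%N -> g ^+ n <= e.
Proof.
move=> /andP[g0 g1] e e0; have g1' : `|g| < 1 by rewrite ger0_norm.
have /cvgrPdist_le /(_ _ e0) [N _ hN] := cvg_expr g1'.
exists N => n /hN; rewrite /= sub0r normrN; exact/le_trans/ler_norm.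
Qed.

Lemma opbound_exp T g : 0 <= g -> (forall x, nrm (T x) <= g * nrm x) ->
  forall n x, nrm ((T ^+ n) x) <= g ^+ n * nrm x.
Proof.
move=> g0 hT; elim=> [|n IH] x; first by rewrite !expr0 mul1r.
rewrite !exprS bopM (le_trans (hT _))// -mulrA ler_wpM2l//; exact: IH.
Qed.

(** The inverse is the sum of the geometric series, whose partial sums are Cauchy by comparison with
    the scalar series. *)
Lemma neumann T g : 0 <= g < 1 -> (forall x, nrm (T x) <= g * nrm x) ->
  bop_invertible (1 - T).
Proof.
move=> g01 hT; have /andP[g0 g1] := g01.
have hTn := opbound_exp g0 hT.
pose S n := \sum_(i < n) T ^+ i.
(* Multiplying by 1 - g turns the tail of the scalar series into a telescoping difference and avoids
   division. *)
have S_le m n x : (m <= n)%N -> (1 - g) * nrm ((S n - S m) x) <= (g ^+ m - g ^+ n) * nrm x.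
  elim: n => [|n IH]; first by rewrite leqn0 => /eqP ->; rewrite !subrr bop0 nrm0 mulr0 mul0r.
  rewrite leq_eqVlt => /predU1P[->|]; first by rewrite !subrr bop0 nrm0 mulr0 mul0r.
  rewrite ltnS => /IH {}IH; rewrite /S big_ord_recr -addrAC bopD.
  have := nrmD ((S n - S m) x) ((T ^+ n) x); have := hTn n x; rewrite exprSr.
  move: IH; rewrite -/(S n) -/(S m); nra.
have [|V hV] := @bop_complete _ H S.
  move=> e e0; have [|N hN] := expr_lim g01 (_ : 0 < e * (1 - g)).
    by rewrite mulr_gt0// subr_gt0.
  exists N => n m; wlog mn : n m / (m <= n)%N.
    move=> W Nn Nm x; have [|/ltnW] := leqP m n; first by move/W; apply.
    by move/W => /(_ Nm Nn x); rewrite -nrmN -bopN opprB.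
  move=> Nn Nm x; rewrite -(ler_pM2l (_ : 0 < 1 - g)) ?subr_gt0//.
  rewrite (le_trans (S_le _ _ _ mn))// mulrA ler_wpM2r ?nrm_ge0//.
  have := hN _ Nm; have : 0 <= g ^+ n by rewrite exprn_ge0.
  lra.
have S1 n : S n * (1 - T) = 1 - T ^+ n.
  rewrite /S mulr_suml; elim: n => [|n IH]; first by rewrite big_ord0 expr0 subrr.
  by rewrite big_ord_recr /= IH mulrBr mulr1 -exprSr addrA subrK.
have S2 n : (1 - T) * S n = 1 - T ^+ n.
  rewrite /S mulr_sumr; elim: n => [|n IH]; first by rewrite big_ord0 expr0 subrr.
  by rewrite big_ord_recr /= IH mulrBl mul1r -exprS addrA subrK.
have [M M0 hM] := bop_bounded (1 - T).
(* With tolerance e / (M + 1), replacing [V] by [S n] costs M shares, M being a bound for [1 - T],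
   and the remainder [T ^+ n] costs one. *)
have lim (e : R) : 0 < e -> exists n, (forall x, nrm ((S n - V) x) <= e / (M + 1) * nrm x)
    /\ g ^+ n <= e / (M + 1).
  move=> e0; have e1 : 0 < e / (M + 1) by rewrite divr_gt0 ?addr_gt0.
  have [N1 h1] := hV _ e1; have [N2 h2] := expr_lim g01 e1.
  exists (maxn N1 N2); split; first by apply: h1; rewrite leq_maxl.
  by apply: h2; rewrite leq_maxr.
exists V; split; apply/eqP; rewrite -subr_eq0; apply/eqP/bop_eq0_lim => e /lim[n [h1 h2]] x.
- have -> : V * (1 - T) - 1 = - ((S n - V) * (1 - T)) - T ^+ n.
    by rewrite mulrBl S1 opprB -addrA -opprD subrK.
  rewrite bopB bopN (le_trans (nrmB _ _))// nrmN bopM.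
  have := h1 ((1 - T) x); have := hTn n x; have := hM x; have := nrm_ge0 x.
  set a := nrm _; set b := nrm _; set d := nrm _; set f := nrm _ => a0 hb hd hf.
  have e0 : 0 <= e / (M + 1) by apply: le_trans h2; rewrite exprn_ge0.
  have -> : e = e / (M + 1) * (M + 1) by field; lra.
  nra.
- have -> : (1 - T) * V - 1 = - ((1 - T) * (S n - V)) - T ^+ n.
    by rewrite mulrBr S2 opprB -addrA -opprD subrK.
  rewrite bopB bopN (le_trans (nrmB _ _))// nrmN bopM.
  have := hM ((S n - V) x); have := hTn n x; have := h1 x; have := nrm_ge0 x.
  set a := nrm _; set b := nrm _; set d := nrm _; set f := nrm _ => a0 hb hd hf.
  have e0 : 0 <= e / (M + 1) by apply: le_trans h2; rewrite exprn_ge0.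
  have -> : e = e / (M + 1) * (M + 1) by field; lra.
  nra.
Qed.

(** For K = M + c, the form of G = 1 - T / K lies between 0 and 1 - c / K < 1; [pos_opbound] makes
    this a norm bound, and the Neumann series inverts 1 - G = T / K. *)
Lemma coercive_invertible T c : 0 < c -> rsa T ->
  (forall x, c * nrm x ^+ 2 <= ip (T x) x) -> bop_invertible T.
Proof.
move=> c0 sT hc; have [M M0 hM] := bop_bounded T.
have MT x : ip (T x) x <= M * nrm x ^+ 2.
  rewrite (le_trans (ler_norm _))// (le_trans (CS _ _))//.
  by rewrite expr2 mulrA ler_wpM2r// nrm_ge0.
pose K := M + c; have K0 : 0 < K by rewrite addr_gt0.
pose G : bop H := 1 - (K^-1)%:C *: T.
have sG : rsa G by apply: rsaB; [exact: rsa1|exact: rsaZ].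
have ipG x : ip (G x) x = nrm x ^+ 2 - ip (T x) x / K.
  by rewrite /G bopB bopZ bop1 ipBl ipZl ipxx mulrC.
have hG x : 0 <= ip (G x) x <= (1 - c / K) * nrm x ^+ 2.
  rewrite ipG subr_ge0 ler_pdivrMr//; apply/andP; split.
    by rewrite /K; have := MT x; have := sqr_ge0 (nrm x); nra.
  by rewrite mulrBl mul1r lerD2l lerN2 mulrAC ler_pM2r ?invr_gt0.
have g0 : 0 <= 1 - c / K < 1.
  rewrite subr_ge0 ler_pdivrMr// mul1r gtrBl divr_gt0// andbT /K; lra.
have [V [V1 V2]] := neumann g0 (pos_opbound (proj1 (andP g0)) sG hG).
have E : 1 - G = (K^-1)%:C *: T by rewrite /G opprB addrC subrK.
move: V1 V2; rewrite E => V1 V2; exists ((K^-1)%:C *: V).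
by rewrite -bop_scaleAl bop_scaleAr V1 -bop_scaleAr bop_scaleAl V2.
Qed.

Lemma invertibleM S T : bop_invertible S -> bop_invertible T -> bop_invertible (S * T).
Proof.
move=> [S' [S1 S2]] [T' [T1 T2]]; exists (T' * S'); split.
  by rewrite mulrA -(mulrA T') S1 mulr1.
by rewrite mulrA -(mulrA S) T2 mulr1.
Qed.

Lemma invertibleZ (a : R[i]) T : a != 0 -> bop_invertible T -> bop_invertible (a *: T).
Proof.
move=> a0 [S [h1 h2]]; exists (a^-1 *: S).
by split; rewrite -bop_scaleAl -bop_scaleAr scalerA ?h1 ?h2 ?mulVf ?mulfV ?scale1r.
Qed.

Lemma invertible1 : bop_invertible (1 : bop H).
Proof. by exists 1; rewrite mulr1. Qed.

(** With [U] the inverse of the product, [U * S] is a left inverse and [S * U] a right inverse of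
    [T], hence they coincide. *)
Lemma invertible_factor S T : S * T = T * S -> bop_invertible (S * T) -> bop_invertible T.
Proof.
move=> cST [U [U1 U2]]; exists (U * S); split; first by rewrite -mulrA.
have TSU : T * (S * U) = 1 by rewrite mulrA -cST.
suff -> : U * S = S * U by [].
by rewrite -[U * S]mulr1 -TSU mulrA -(mulrA U) U1 mul1r.
Qed.

Lemma mul_shift T (u v : R[i]) : (T + u *: (1 : bop H)) * (T + v *: (1 : bop H)) =
  T * T + (u + v) *: T + (u * v) *: (1 : bop H).
Proof.
rewrite mulrDl !mulrDr -!bop_scaleAl -!bop_scaleAr !mul1r mulr1 scalerA.
by rewrite scalerDl !addrA (addrAC _ (v *: T)).
Qed.

(** The product (T + ib)(T - ib) = T^2 + b^2 is coercive with constant b^2, and the factors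
    commute. *)
Lemma imag_invertible T (b : R) : rsa T -> b != 0 ->
  bop_invertible (T - ('i%C * b%:C) *: (1 : bop H)).
Proof.
move=> sT b0; set w := 'i%C * b%:C.
have ww : w * - w = (b ^+ 2)%:C.
  by rewrite mulrN -expr2 exprMn sqr_i mulN1r opprK rmorphXn.
rewrite -scaleNr; apply: (@invertible_factor (T + w *: (1 : bop H))).
  by rewrite !mul_shift (addrC w) (mulrC w).
rewrite mul_shift subrr scale0r addr0 ww.
apply: (@coercive_invertible _ (b ^+ 2)).
- by rewrite exprn_even_gt0.
- apply: rsaD; last by apply: rsaZ; exact: rsa1.
  by move=> x y; rewrite !bopM !sT.
- move=> x; rewrite bopD bopZ bop1 ipDl ipZl bopM sT !ipxx lerDr.
  by rewrite sqr_ge0.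
Qed.

Lemma nonreal_invertible T (z : R[i]) : rsa T -> complex.Im z != 0 ->
  bop_invertible (T - z *: (1 : bop H)).
Proof.
move=> sT b0; set a := complex.Re z.
have -> : T - z *: (1 : bop H) =
    T - a%:C *: (1 : bop H) - ('i%C * (complex.Im z)%:C) *: (1 : bop H).
  by rewrite -addrA -opprD -scalerDl -complexE.
by apply: imag_invertible => //; apply: rsaB => //; apply: rsaZ; exact: rsa1.
Qed.

(** [pos_CS] at the pair x, T x, divided by |Tx|^2. *)
Lemma pos_nrm_sqr T M : rsa T -> (forall x, 0 <= ip (T x) x) ->
  (forall x, nrm (T x) <= M * nrm x) -> forall x, nrm (T x) ^+ 2 <= M * ip (T x) x.
Proof.
move=> sT pT hM x; have := @pos_CS _ _ T sT pT x (T x); rewrite ipxx => h.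
have h1 : ip (T (T x)) (T x) <= M * nrm (T x) ^+ 2.
  rewrite (le_trans (ler_norm _))// (le_trans (CS _ _))//.
  by rewrite expr2 mulrA ler_wpM2r// nrm_ge0.
have [n0|n0] := eqVneq (nrm (T x)) 0.
  have T0 := nrm_eq0 n0; rewrite T0 ip0l mulr0 nrm0; lra.
have n1 : 0 < nrm (T x) ^+ 2 by rewrite exprn_gt0// lt_neqAle eq_sym n0 nrm_ge0.
have := pT x; nra.
Qed.

(** If [k] bounds the inverse, then |x|^2 <= k^2 |Tx|^2 <= k^2 M ip (T x) x, which gives the
    constant. *)
Lemma pos_invertible_coercive T : rsa T -> (forall x, 0 <= ip (T x) x) ->
  bop_invertible T -> exists2 c, 0 < c & forall x, c * nrm x ^+ 2 <= ip (T x) x.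
Proof.
move=> sT pT [S [ST TS]]; have [M M0 hM] := bop_bounded T.
have [k k0 hk] := bop_bounded S.
exists ((k ^+ 2 * M)^-1); first by rewrite invr_gt0 mulr_gt0// exprn_gt0.
move=> x; rewrite mulrC ler_pdivrMr ?mulr_gt0 ?exprn_gt0//.
have := hk (T x); rewrite -bopM ST bop1 => h.
have h2 := pos_nrm_sqr sT pT hM x.
apply: (@le_trans _ _ ((k * nrm (T x)) ^+ 2)).
  by rewrite ler_sqr ?nnegrE ?mulr_ge0 ?nrm_ge0// ltW.
have -> : ip (T x) x * (k ^+ 2 * M) = k ^+ 2 * (M * ip (T x) x) by ring.
by rewrite exprMn ler_wpM2l ?sqr_ge0.
Qed.

Lemma rsa_shift T c : rsa T -> rsa (T - c%:C *: (1 : bop H)).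
Proof. by move=> sT; apply: rsaB => //; apply: rsaZ; exact: rsa1. Qed.

Lemma ip_shift T c x : ip ((T - c%:C *: (1 : bop H)) x) x = ip (T x) x - c * nrm x ^+ 2.
Proof. by rewrite bopB bopZ bop1 ipBl ipZl ipxx. Qed.

(** Take m as the largest lower bound of the form. If T - m were invertible it would be coercive,
    and the bound could be raised. The nonzero vector excludes the zero space, where the spectrum is
    empty. *)
Lemma spectrum_inf T x0 : x0 != 0 -> rsa T ->
  exists m, spectrum T m%:C /\ forall x, m * nrm x ^+ 2 <= ip (T x) x.
Proof.
move=> x00 sT; have [M M0 hM] := bop_bounded T.
pose E := [set c : R | forall x, c * nrm x ^+ 2 <= ip (T x) x]%classic.
have sq_gt0 x : x != 0 -> 0 < nrm x ^+ 2.
  move=> xn0; rewrite exprn_even_gt0//=; apply: contra xn0 => /eqP/nrm_eq0 ->.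
  by [].
have ubE x : x != 0 -> ubound E (ip (T x) x / nrm x ^+ 2).
  by move=> xn0 c /(_ x); rewrite ler_pdivlMr// sq_gt0.
have supE : has_sup E.
  split; last by exists (ip (T x0) x0 / nrm x0 ^+ 2); exact: ubE.
  exists (- M) => x; rewrite mulNr lerNl -ipNl.
  rewrite (le_trans (ler_norm _))// (le_trans (CS _ _))// nrmN.
  by rewrite expr2 mulrA ler_wpM2r// nrm_ge0.
have hm x : sup E * nrm x ^+ 2 <= ip (T x) x.
  have [->|xn0] := eqVneq x 0; first by rewrite nrm0 expr0n mulr0 bop_at0 ip0l.
  rewrite -ler_pdivlMr ?sq_gt0//; apply: ge_sup; first by case: supE.
  exact: ubE.
exists (sup E); split=> // inv.
have [|c c0 hc] := pos_invertible_coercive (rsa_shift (sup E) sT) _ inv.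
  by move=> x; rewrite ip_shift subr_ge0.
have : E (sup E + c).
  by move=> x; have := hc x; rewrite ip_shift mulrDl; lra.
by move=> /(ub_le_sup (proj2 supE)); rewrite gerDl leNgt c0.
Qed.

End Invertibility.

(** * Spectral mapping for polynomials *)

Section SpectralMapping.
Variables (R : realType) (H : hilbertType R).
Implicit Types (x y : H) (c e M : R) (T S : bop H) (p q : {poly R[i]}).

(** Complex coefficients, so that polynomials split into linear factors. *)
Definition cpoly (p : {poly R[i]}) T : bop H := \sum_(i < size p) p`_i *: T ^+ i.

Lemma cpolyE n p T : (size p <= n)%N -> cpoly p T = \sum_(i < n) p`_i *: T ^+ i.
Proof.
move=> pn; rewrite /cpoly (big_ord_widen n (fun i => p`_i *: T ^+ i))// big_mkcond.
apply: eq_bigr => i _; case: ltnP => // /(nth_default 0) ->.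
by rewrite scale0r.
Qed.

Lemma cpolyD p q T : cpoly (p + q) T = cpoly p T + cpoly q T.
Proof.
pose n := maxn (size p) (size q).
rewrite (@cpolyE n p) ?leq_maxl// (@cpolyE n q) ?leq_maxr// (@cpolyE n (p + q)) ?size_polyD//.
by rewrite -big_split; apply: eq_bigr => i _; rewrite coefD scalerDl.
Qed.

Lemma cpolyZ (a : R[i]) p T : cpoly (a *: p) T = a *: cpoly p T.
Proof.
rewrite (@cpolyE (size p) (a *: p)) ?size_scale_leq// /cpoly scaler_sumr.
by apply: eq_bigr => i _; rewrite coefZ scalerA.
Qed.

Lemma cpolyC (a : R[i]) T : cpoly a%:P T = a *: (1 : bop H).
Proof. by rewrite (@cpolyE 1) ?size_polyC_leq1// big_ord1 coefC expr0. Qed.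

Lemma cpolyMX p T : cpoly (p * 'X) T = cpoly p T * T.
Proof.
rewrite (@cpolyE (size p).+1); last first.
  by rewrite (leq_trans (size_polyMleq _ _))// size_polyX addn2.
rewrite big_ord_recl coefMX eqxx scale0r add0r /cpoly mulr_suml.
by apply: eq_bigr => i _; rewrite coefMX /= exprSr bop_scaleAl.
Qed.

Lemma cpolyX T : cpoly 'X T = T.
Proof. by rewrite -[ 'X]mul1r cpolyMX (cpolyC 1) scale1r mul1r. Qed.

Lemma cpolyM p q T : cpoly (p * q) T = cpoly p T * cpoly q T.
Proof.
elim/poly_ind : q => [|q c IH].
  by rewrite mulr0 -(rmorph0 (@polyC _)) cpolyC scale0r mulr0.
rewrite mulrDr mulrA [p * c%:P]mulrC mul_polyC !cpolyD !cpolyMX cpolyZ IH cpolyC.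
by rewrite mulrDr mulrA -bop_scaleAr mulr1.
Qed.

Lemma cpoly_invertible p T : p != 0 ->
  (forall z, root p z -> bop_invertible (T - z *: (1 : bop H))) -> bop_invertible (cpoly p T).
Proof.
move=> p0 hT; have [r pE] := closed_field_poly_normal p.
have a0 : lead_coef p != 0 by rewrite lead_coef_eq0.
have {}hT z : z \in r -> bop_invertible (T - z *: (1 : bop H)).
  by move=> zr; apply: hT; rewrite pE rootZ// root_prod_XsubC.
rewrite pE cpolyZ; apply: invertibleZ => //.
elim: r hT {pE} => [|z r IH] hT; first by rewrite big_nil (cpolyC 1) scale1r; exact: invertible1.
rewrite big_cons cpolyM; apply: invertibleM; last first.
  by apply: IH => w wr; apply: hT; rewrite inE wr orbT.
rewrite -polyCN cpolyD cpolyX cpolyC scaleNr.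
by apply: hT; rewrite inE eqxx.
Qed.

Lemma op_polyE (p : {poly R}) T : op_poly p T = cpoly (map_poly (real_complex R) p) T.
Proof.
rewrite /op_poly /cpoly size_map_poly.
by apply: eq_bigr => i _; rewrite coef_map.
Qed.

Lemma op_polyD (p q : {poly R}) T : op_poly (p + q) T = op_poly p T + op_poly q T.
Proof. by rewrite !op_polyE rmorphD cpolyD. Qed.

Lemma op_polyC c T : op_poly c%:P T = c%:C *: (1 : bop H).
Proof. by rewrite op_polyE map_polyC cpolyC. Qed.

Lemma op_polyX T : op_poly 'X T = T.
Proof. by rewrite op_polyE map_polyX cpolyX. Qed.

Lemma op_polyM (p q : {poly R}) T : op_poly (p * q) T = op_poly p T * op_poly q T.
Proof. by rewrite !op_polyE rmorphM cpolyM. Qed.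

Lemma op_polyN (p : {poly R}) T : op_poly (- p) T = - op_poly p T.
Proof.
by rewrite -mulN1r op_polyM -(rmorphN1 (@polyC _)) op_polyC rmorphN1 scaleN1r mulN1r.
Qed.

Lemma op_polyB (p q : {poly R}) T : op_poly (p - q) T = op_poly p T - op_poly q T.
Proof. by rewrite op_polyD op_polyN. Qed.

Lemma rsaX T n : rsa T -> rsa (T ^+ n).
Proof.
move=> sT; elim: n => [|n IH]; first exact: rsa1.
by move=> x y; rewrite {1}exprS exprSr !bopM sT IH.
Qed.

Lemma rsa_op_poly (p : {poly R}) T : rsa T -> rsa (op_poly p T).
Proof. by move=> sT; apply: rsa_sum => i; apply: rsaZ; exact: rsaX. Qed.

(** If p took the value c nowhere on the spectrum, every root z of p - c would give an invertible
    factor T - z, the nonreal ones because T is self-adjoint, and p(T) - c would be invertible. *)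
Lemma spectrum_op_poly (p : {poly R}) T c x : x != 0 -> rsa T ->
  spectrum (op_poly p T) c%:C -> exists2 t, spectrum T t%:C & p.[t] = c.
Proof.
move=> x0 sT; have -> : spectrum (op_poly p T) c%:C =
    ~ bop_invertible (cpoly (map_poly (real_complex R) (p - c%:P)) T).
  by rewrite -op_polyE op_polyB op_polyC.
(* For constant p equal to c there are no roots to use, and any point of the spectrum will do;
   [spectrum_inf] provides one. *)
move=> hp; have [q0|q0] := eqVneq (p - c%:P) 0.
  have [m [mT _]] := spectrum_inf x0 sT; exists m => //.
  by move/eqP: q0; rewrite subr_eq0 => /eqP ->; rewrite hornerC.
apply/not_exists2P => hn; apply: hp; apply: cpoly_invertible.
  by rewrite map_poly_eq0.
move=> z; have [iz|iz _] := eqVneq (complex.Im z) 0; last exact: nonreal_invertible.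
have -> : z = (complex.Re z)%:C by rewrite [LHS]complexE iz mulr0 addr0.
rewrite /root horner_map /= fmorph_eq0 hornerD hornerN hornerC subr_eq0 => /eqP pz.
by apply: contrapT => zT; case: (hn (complex.Re z)).
Qed.

(** The infimum of the form of p(T) lies in the spectrum of p(T), hence is a value of p on the
    spectrum of T. *)
Lemma op_poly_ge0 (p : {poly R}) T : rsa T ->
  (forall t, spectrum T t%:C -> 0 <= p.[t]) -> forall x, 0 <= ip (op_poly p T x) x.
Proof.
move=> sT hp x; have [->|x0] := eqVneq x 0; first by rewrite bop_at0 ip0l.
have [m [mp hm]] := spectrum_inf x0 (rsa_op_poly p sT).
have [t tT pt] := spectrum_op_poly x0 sT mp.
by rewrite (le_trans _ (hm x))// mulr_ge0 ?sqr_ge0// -pt hp.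
Qed.

Lemma op_poly_bound (p : {poly R}) T e : 0 <= e -> rsa T ->
  (forall t, spectrum T t%:C -> `|p.[t]| <= e) -> forall x, nrm (op_poly p T x) <= e * nrm x.
Proof.
move=> e0 sT hp x.
have := @op_poly_ge0 ((e ^+ 2)%:P - p * p) T sT _ x.
rewrite op_polyB op_polyC op_polyM bopB bopZ bop1 bopM ipBl ipZl (rsa_op_poly p sT) !ipxx.
rewrite subr_ge0 -exprMn ler_sqr ?nnegrE ?mulr_ge0 ?nrm_ge0//; apply=> t tT.
rewrite hornerD hornerN hornerC hornerM subr_ge0 -expr2 -[leLHS]real_normK ?num_real//.
by rewrite ler_sqr ?nnegrE// hp.
Qed.

End SpectralMapping.

(** * The Weierstrass approximation theorem *)

Section Weierstrass.
Variable R : realType.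
Implicit Types (f : R -> R) (a b e t : R).

Lemma within_continuous_dist (J : interval R) f t e :
  {within [set` J], continuous f}%classic -> t \in J -> 0 < e ->
  exists2 d, 0 < d & forall s, s \in J -> `|s - t| < d -> `|f s - f t| <= e.
Proof.
move=> /subspace_continuousP cf tJ e0.
have /cvgrPdist_le /(_ _ e0) := cf t tJ.
rewrite near_withinE => /nbhs_ballP[d /= d0 hd].
exists d => // s sJ st; rewrite distrC; apply: (hd s) => //.
by rewrite -ball_normE /= distrC.
Qed.

(** A quadratic error term is one that Bernstein polynomials evaluate exactly. Near the diagonal
    continuity gives the bound, away from it a large L does, and compactness makes L uniform in
    t. *)
Lemma continuous_quadratic_modulus f a b e : {within `[a, b], continuous f}%classic -> 0 < e ->
  exists2 L, 0 <= L & forall s t, s \in `[a, b] -> t \in `[a, b] ->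
    `|f s - f t| <= e + L * (s - t) ^+ 2.
Proof.
move=> cf e0.
have [M hM] : exists M, forall s, s \in `[a, b] -> `|f s| <= M.
  have /compact_bounded[M [_ hM]] := continuous_compact cf (@segment_compact _ a b).
  by exists (M + 1) => s sab; apply: (hM (M + 1)); [rewrite ltrDl|exists s].
pose P (L t : R) := t \in `[a, b] ->
  forall s, s \in `[a, b] -> `|f s - f t| <= e + L * (s - t) ^+ 2.
have cov : forall x, `[a, b]%classic x -> \forall x' \near x & L \near pinfty_nbhs R, P L x'.
  move=> x xab; have [|d d0 hd] := within_continuous_dist cf xab (_ : 0 < e / 2).
    by rewrite divr_gt0.
  (* Chosen so that L1 (d / 2)^2 = 2 M, the largest possible value of |f s - f t|. *)
  pose L1 := 8 * M / d ^+ 2.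
  exists ([set y | `|y - x| < d / 2], [set L | L1 < L])%classic => /=.
    split; last by exists L1; split; rewrite ?num_real.
    apply/nbhs_ballP; exists (d / 2) => /=; first by rewrite divr_gt0.
    by move=> y; rewrite -ball_normE /= distrC.
  move=> [y L] /= [yx LL1] yab s sab.
  have [sx|sx] := ltP `|s - x| d.
    have h1 := hd _ sab sx.
    have h2 : `|f y - f x| <= e / 2 by apply: hd => //; apply: lt_le_trans yx _; lra.
    have L0 : 0 <= L.
      apply: le_trans (ltW LL1); rewrite divr_ge0 ?sqr_ge0// mulr_ge0//.
      exact: le_trans (hM _ sab).
    have := ler_distD (f x) (f s) (f y); rewrite (distrC (f x)).
    have := mulr_ge0 L0 (sqr_ge0 (s - y)); lra.
  have sy : d / 2 <= `|s - y|.
    have := ler_distD y s x; lra.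
  have : (d / 2) ^+ 2 <= (s - y) ^+ 2.
    by rewrite -[leRHS]real_normK ?num_real// ler_sqr ?nnegrE//; lra.
  have M0 : 0 <= M by exact: le_trans (hM _ sab).
  have : 2 * M = L1 * (d / 2) ^+ 2 by rewrite /L1; field; lra.
  have := ler_normB (f s) (f y); have := hM _ sab; have := hM _ yab.
  have L10 : 0 <= L1 by rewrite divr_ge0 ?sqr_ge0// mulr_ge0.
  set u := (s - y) ^+ 2; set v := (d / 2) ^+ 2; have v0 : 0 <= v by exact: sqr_ge0.
  move=> h1 h2 h3 h4 h5; have : L1 * v <= L * u by nra.
  lra.
have [L0 [_ hL]] := (proj1 (compact_near_coveringP _)) (@segment_compact _ a b)
  R (pinfty_nbhs R) P _ cov.
exists (`|L0| + 1); first by rewrite addr_ge0.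
move=> s t sab tab; apply: (hL (`|L0| + 1)) => //.
by rewrite (le_lt_trans (ler_norm _))// ltrDl.
Qed.

(* The Bernstein operator as an expectation: n Bernoulli('X) steps, each of which shifts phi. *)
Fixpoint bernstein (n : nat) (phi : nat -> R) : {poly R} :=
  if n is m.+1 then 'X * bernstein m (fun k => phi k.+1) + (1 - 'X) * bernstein m phi
  else (phi 0%N)%:P.

Lemma bernstein_le n (phi psi : nat -> R) x : 0 <= x <= 1 ->
  (forall k, (k <= n)%N -> phi k <= psi k) -> (bernstein n phi).[x] <= (bernstein n psi).[x].
Proof.
move=> x01; elim: n phi psi => [|n IH] phi psi h; first by rewrite !hornerC h.
rewrite /= !hornerE !lerD//; apply: ler_wpM2l; do ?lra; apply: IH => k kn; apply: h => //.
exact: leqW.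
Qed.

(** The second moment of a binomial variable about c: squared bias plus the variance n x (1 - x).
    The induction is over all c because the shift k + 1 turns c into c - 1. *)
Lemma bernstein_quadratic n x (u v c : R) :
  (bernstein n (fun k => u + v * (k%:R - c) ^+ 2)).[x] =
  u + v * ((n%:R * x - c) ^+ 2 + n%:R * x * (1 - x)).
Proof.
elim: n c => [|n IH] c /=; first by rewrite hornerC; ring.
have -> : (fun k => u + v * (k.+1%:R - c) ^+ 2) = (fun k => u + v * (k%:R - (c - 1)) ^+ 2).
  by apply/funext => k; rewrite -natr1; ring.
rewrite !hornerE !IH -natr1; ring.
Qed.

(** [bernstein_le] is applied to the quadratic bounds of f around f t from below and above; at the
    centre n x only the variance term survives. *)
Lemma weierstrass f a b e : {within `[a, b], continuous f}%classic -> 0 < e ->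
  exists p : {poly R}, forall t, t \in `[a, b] -> `|p.[t] - f t| <= e.
Proof.
move=> cf e0; have [ab|ab] := ltP a b; last first.
  exists (f a)%:P => t; rewrite in_itv /= => /andP[h1 h2].
  have -> : t = a by apply/le_anti; rewrite h1 (le_trans h2).
  by rewrite hornerC subrr normr0 ltW.
have [|L L0 hL] := continuous_quadratic_modulus cf (_ : 0 < e / 2); first by rewrite divr_gt0.
pose D := b - a; have D0 : 0 < D by rewrite subr_gt0.
(* This n makes the variance term L D^2 x (1 - x) / n at most e / 2. *)
have [n hn] : exists n : nat, L * D ^+ 2 / (e / 2) < n%:R.
  exists (Num.bound (L * D ^+ 2 / (e / 2))); apply: archi_boundP.
  by rewrite divr_ge0 ?mulr_ge0 ?sqr_ge0//; lra.
have n0 : 0 < n%:R :> R.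
  by apply: le_lt_trans hn; rewrite divr_ge0 ?mulr_ge0 ?sqr_ge0//; lra.
pose phi k := f (a + D * (k%:R / n%:R)).
(* The inner polynomial maps [a, b] affinely onto [0, 1]. *)
exists (bernstein n phi \Po (D^-1 *: ('X - a%:P))) => t tab.
rewrite horner_comp !hornerE; set x := D^-1 * (t - a).
have x01 : 0 <= x <= 1.
  move: tab; rewrite in_itv /= => /andP[h1 h2]; rewrite /x mulrC.
  apply/andP; split; first by rewrite divr_ge0 ?subr_ge0// ltW.
  rewrite ler_pdivrMr// mul1r /D; lra.
have tE : t = a + D * x by rewrite /x; field; lra.
(* The constant L in units of the grid: the k-th node minus t is D / n times k - n x. *)
pose be := L * D ^+ 2 / n%:R ^+ 2.
have hk k : (k <= n)%N -> `|phi k - f t| <= e / 2 + be * (k%:R - n%:R * x) ^+ 2.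
  move=> kn; have k01 : 0 <= (k%:R / n%:R : R) <= 1.
    apply/andP; split; first by apply: divr_ge0; exact: ler0n.
    by rewrite ler_pdivrMr// mul1r ler_nat.
  have kab : a + D * (k%:R / n%:R) \in `[a, b].
    rewrite in_itv /=; move: k01; set y := _ / _ => /andP[y0 y1]; apply/andP; split.
      by rewrite lerDl mulr_ge0// ltW.
    have : D * y <= D by rewrite ger_pMr.
    rewrite /D; lra.
  have E : L * (a + D * (k%:R / n%:R) - t) ^+ 2 = be * (k%:R - n%:R * x) ^+ 2.
    by rewrite /be [in LHS]tE; field; lra.
  by have := hL _ _ kab tab; rewrite E.
have bx : be * ((n%:R * x - n%:R * x) ^+ 2 + n%:R * x * (1 - x)) <= e / 2.
  have -> : be * ((n%:R * x - n%:R * x) ^+ 2 + n%:R * x * (1 - x)) =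
     L * D ^+ 2 / n%:R * (x * (1 - x)) by rewrite /be; field; lra.
  have h : L * D ^+ 2 / n%:R <= e / 2.
    by rewrite ler_pdivrMr// (mulrC (e / 2)) -ler_pdivrMr ?divr_gt0// ltW.
  have : 0 <= L * D ^+ 2 / n%:R.
    by apply: divr_ge0; [apply: mulr_ge0 => //; exact: sqr_ge0|exact: ltW].
  have [x0 x1] := andP x01; have : 0 <= x * (1 - x) <= 1 by nra.
  nra.
rewrite ler_distl; apply/andP; split.
- have /(bernstein_le x01) : forall k, (k <= n)%N ->
      (f t - e / 2) + (- be) * (k%:R - n%:R * x) ^+ 2 <= phi k.
    move=> k /hk; rewrite ler_distl; lra.
  rewrite bernstein_quadratic; lra.
- have /(bernstein_le x01) : forall k, (k <= n)%N ->
      phi k <= (f t + e / 2) + be * (k%:R - n%:R * x) ^+ 2.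
    move=> k /hk; rewrite ler_distl; lra.
  rewrite bernstein_quadratic; lra.
Qed.

End Weierstrass.

(** * Continuous functional calculus *)

Section FunctionalCalculus.
Variables (R : realType) (H : hilbertType R).
Implicit Types (x y : H) (a b c e M t : R) (T S : bop H) (p q : {poly R}) (f g : R -> R).

Lemma le0_small (u v : R) : (forall e, 0 < e -> u <= e * v) -> u <= 0.
Proof.
move=> h; have [v0|v0] := leP v 0; first by have := h 1 ltr01; lra.
apply/ler_addgt0Pr => e e0; rewrite add0r.
by have := h (e / v); rewrite divfK ?gt_eqF//; apply; rewrite divr_gt0.
Qed.

(** For t below a the operator T - t is coercive, and for t above b the operator t - T is. *)
Lemma spectrum_bounds T a b t : rsa T ->
  (forall x, a * nrm x ^+ 2 <= ip (T x) x <= b * nrm x ^+ 2) ->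
  spectrum T t%:C -> a <= t <= b.
Proof.
move=> sT hT tT; apply/andP; split; rewrite leNgt; apply/negP => ta; apply: tT.
  apply: (@coercive_invertible _ _ _ (a - t)); first by rewrite subr_gt0.
    exact: rsa_shift.
  by move=> x; have /andP[h _] := hT x; rewrite ip_shift mulrBl lerD2r.
have -> : T - t%:C *: (1 : bop H) = (-1) *: (t%:C *: (1 : bop H) - T).
  by rewrite scaleN1r opprB.
apply: invertibleZ; first by rewrite oppr_eq0 oner_eq0.
apply: (@coercive_invertible _ _ _ (t - b)); first by rewrite subr_gt0.
  by rewrite -opprB; apply: rsaN; exact: rsa_shift.
by move=> x; have /andP[_ h] := hT x; rewrite bopB bopZ bop1 ipBl ipZl ipxx; lra.
Qed.

Lemma ip_bounds T : exists2 M, 0 < M & forall x, - M * nrm x ^+ 2 <= ip (T x) x <= M * nrm x ^+ 2.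
Proof.
have [M M0 hM] := bop_bounded T; exists M => // x.
rewrite mulNr -ler_norml (le_trans (CS _ _))// expr2 mulrA ler_wpM2r// ?nrm_ge0//.
Qed.

Lemma poly_bounded_spectrum p T : rsa T ->
  exists2 M, 0 < M & forall t, spectrum T t%:C -> `|p.[t]| <= M.
Proof.
move=> sT; have [K K0 hK] := ip_bounds T.
have {hK}hK t : spectrum T t%:C -> `|t| <= K.
  by move=> /(spectrum_bounds sT hK); rewrite ler_norml.
elim/poly_ind : p => [|p c [M M0 IH]]; first by exists 1 => // t _; rewrite horner0 normr0.
exists (M * K + `|c|).
  by rewrite ltr_pwDl// mulr_gt0.
move=> t tT; rewrite !hornerE (le_trans (ler_normD _ _))// lerD2r normrM.
by rewrite ler_pM// ?IH// hK.
Qed.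

(** The definition of [is_cfc] only provides some good polynomials. For an arbitrary p, compare it
    with a provided q: on the spectrum p - q is at most e + d, so [op_poly_bound] applies, and d is
    arbitrary. *)
Lemma is_cfc_approx f T S p e : rsa T -> is_cfc f T S -> 0 <= e ->
  (forall t, spectrum T t%:C -> `|p.[t] - f t| <= e) ->
  forall x, nrm ((op_poly p T - S) x) <= e * nrm x.
Proof.
move=> sT hS e0 hp x; rewrite -subr_le0; apply: (@le0_small _ (2 * nrm x)) => d d0.
have [q [hq qS]] := hS d d0.
have hpq : forall t, spectrum T t%:C -> `|(p - q).[t]| <= e + d.
  move=> t tT; rewrite hornerD hornerN.
  have := ler_distD (f t) p.[t] q.[t]; have := hp t tT; have := hq t tT.
  rewrite (distrC q.[t]); lra.
have ed : 0 <= e + d by rewrite addr_ge0// ltW.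
have := op_poly_bound ed sT hpq x; have := qS x.
rewrite !normE -rmorphM lecR op_polyB !bopB.
have := nrm_triangle (op_poly p T x) (op_poly q T x) (S x); lra.
Qed.

Lemma is_cfcP f T S : is_cfc f T S <-> forall e, 0 < e -> exists p,
    (forall t, spectrum T t%:C -> `|p.[t] - f t| <= e) /\
    (forall x, nrm ((op_poly p T - S) x) <= e * nrm x).
Proof.
by split=> h e /h[p [h1 h2]]; exists p; split=> // x; have := h2 x;
  rewrite !normE -rmorphM lecR.
Qed.

Lemma is_cfc_uniq f T S S' : rsa T -> is_cfc f T S -> is_cfc f T S' -> S = S'.
Proof.
move=> sT hS hS'; apply/eqP; rewrite -subr_eq0; apply/eqP/bop_eq0_lim => e e0 x.
have e2 : 0 < e / 2 by rewrite divr_gt0.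
have /is_cfcP /(_ _ e2)[p [hp pS]] := hS.
have := is_cfc_approx sT hS' (ltW e2) hp x; have := pS x.
rewrite !bopB (nrm_distC _ (S x)).
have := nrm_triangle (S x) (op_poly p T x) (S' x); lra.
Qed.

Lemma cfcE f T S : rsa T -> is_cfc f T S -> cfc f T = S.
Proof.
move=> sT hS; apply: (is_cfc_uniq sT _ hS).
exact: (@xgetPex _ 0 [set S | is_cfc f T S]%classic (ex_intro _ _ hS)).
Qed.

Lemma is_cfc_op_poly p T : is_cfc (horner p) T (op_poly p T).
Proof.
apply/is_cfcP => e e0; exists p; split=> [t _|x].
  by rewrite subrr normr0 ltW.
by rewrite subrr bop0 nrm0 mulr_ge0 ?nrm_ge0 ?ltW.
Qed.

Lemma is_cfc_ext f g T S : (forall t, spectrum T t%:C -> f t = g t) ->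
  is_cfc f T S -> is_cfc g T S.
Proof.
move=> fg hS e /hS[p [h1 h2]]; exists p; split=> // t tT.
by rewrite -fg// h1.
Qed.

Lemma is_cfc_id T : is_cfc id T T.
Proof.
rewrite -{2}(op_polyX T); apply: is_cfc_ext (is_cfc_op_poly _ _) => t _.
by rewrite hornerX.
Qed.

Lemma is_cfc_affine T a b : is_cfc (fun t => a + b * t) T (a%:C *: (1 : bop H) + b%:C *: T).
Proof.
have -> : a%:C *: (1 : bop H) + b%:C *: T = op_poly (a%:P + b%:P * 'X) T.
  by rewrite op_polyD op_polyM !op_polyC op_polyX -bop_scaleAl mul1r.
by apply: is_cfc_ext (is_cfc_op_poly _ _) => t _; rewrite !hornerE.
Qed.

(** Both the scalar and the operator estimates rest on pq - fg = (p - f) q + f (q - g). *)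
Lemma is_cfc_mul f g T S S' : rsa T -> is_cfc f T S -> is_cfc g T S' ->
  is_cfc (fun t => f t * g t) T (S * S').
Proof.
move=> sT /is_cfcP hS /is_cfcP hS'; apply/is_cfcP => e e0.
have [F F0 hF] : exists2 F, 0 < F & forall t, spectrum T t%:C -> `|f t| <= F.
  have [p [hp _]] := hS 1 ltr01; have [M M0 hM] := poly_bounded_spectrum p sT.
  exists (M + 1); first by rewrite addr_gt0.
  move=> t tT; have := hp t tT; have := hM t tT; rewrite distrC.
  have := ler_distD p.[t] (f t) 0; rewrite !subr0; lra.
have [MS MS0 hMS] := bop_bounded S.
(* First q is chosen, with a tolerance depending on f and [S] only; the tolerance for p then depends
   on bounds for q on the spectrum and for q(T). *)
have e2 : 0 < e / 2 / (F + MS) by rewrite !divr_gt0 ?addr_gt0.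
have [q [hq qS]] := hS' _ e2.
have [Q Q0 hQ] := poly_bounded_spectrum q sT; have [Mq Mq0 hMq] := bop_bounded (op_poly q T).
have e1 : 0 < e / 2 / (Q + Mq) by rewrite !divr_gt0 ?addr_gt0.
have [p [hp pS]] := hS _ e1.
have bnd (u v w : R) : 0 < u -> 0 < v -> u <= w -> v / w * u <= v.
  by move=> u0 v0 uw; rewrite mulrAC ler_pdivrMr ?ler_pM2l// (lt_le_trans u0).
have h1 : e / 2 / (Q + Mq) * Q <= e / 2 by apply: bnd => //; lra.
have h2 : e / 2 / (Q + Mq) * Mq <= e / 2 by apply: bnd => //; lra.
have h3 : e / 2 / (F + MS) * F <= e / 2 by apply: bnd => //; lra.
have h4 : e / 2 / (F + MS) * MS <= e / 2 by apply: bnd => //; lra.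
exists (p * q); split=> [t tT|x].
  rewrite hornerM; have -> : p.[t] * q.[t] - f t * g t =
    (p.[t] - f t) * q.[t] + f t * (q.[t] - g t) by ring.
  rewrite (le_trans (ler_normD _ _))// !normrM (splitr e) lerD//.
    by apply: le_trans h1; rewrite ler_pM// ?hp ?hQ.
  by apply: le_trans h3; rewrite mulrC ler_pM// ?hq ?hF.
rewrite op_polyM; have -> : op_poly p T * op_poly q T - S * S' =
    (op_poly p T - S) * op_poly q T + S * (op_poly q T - S').
  by rewrite mulrBl mulrBr addrA subrK.
rewrite bopD !bopM (le_trans (nrmD _ _))// (splitr e) mulrDl lerD//.
  rewrite (le_trans (pS _))// (le_trans (ler_wpM2l (ltW e1) (hMq x)))//.
  by rewrite mulrA ler_wpM2r ?nrm_ge0.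
rewrite (le_trans (hMS _))// (le_trans (ler_wpM2l (ltW MS0) (qS x)))//.
by rewrite mulrA (mulrC MS) ler_wpM2r ?nrm_ge0.
Qed.

Lemma is_cfc_rsa f T S : rsa T -> is_cfc f T S -> rsa S.
Proof.
move=> sT /is_cfcP hS x y; apply/eqP; rewrite -subr_eq0 -normr_le0.
apply: (@le0_small _ (2 * (nrm x * nrm y))) => e /hS[p [_ hp]].
have -> : ip (S x) y - ip x (S y) =
    ip x ((op_poly p T - S) y) - ip ((op_poly p T - S) x) y.
  by rewrite !bopB ipBl ipBr (rsa_op_poly p sT x y); ring.
rewrite (le_trans (ler_normB _ _))//.
have := CS x ((op_poly p T - S) y); have := CS ((op_poly p T - S) x) y.
have := ler_wpM2l (nrm_ge0 x) (hp y); have := ler_wpM2r (nrm_ge0 y) (hp x); lra.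
Qed.

Lemma is_cfc_le f g T S S' : rsa T -> is_cfc f T S -> is_cfc g T S' ->
  (forall t, spectrum T t%:C -> f t <= g t) -> forall x, ip (S x) x <= ip (S' x) x.
Proof.
move=> sT /is_cfcP hS /is_cfcP hS' fg x; rewrite -subr_le0.
(* Two of the four e come from the shift that makes q - p nonnegative on the spectrum, one from each
   of the two operator approximations. *)
apply: (@le0_small _ (4 * nrm x ^+ 2)) => e e0.
have [p [hp pS]] := hS e e0; have [q [hq qS]] := hS' e e0.
have := @op_poly_ge0 _ _ (q - p + (2 * e)%:P) T sT _ x.
rewrite op_polyD op_polyB op_polyC bopD bopB bopZ bop1 ipDl ipBl ipZl ipxx => h.
have {}h : 0 <= ip (op_poly q T x) x - ip (op_poly p T x) x + 2 * e * nrm x ^+ 2.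
  apply: h => t tT; rewrite !hornerD hornerN hornerC.
  have := hp t tT; have := hq t tT; have := fg t tT.
  rewrite !ler_distl => h1 /andP[h2 h3] /andP[h4 h5]; lra.
have := CS ((op_poly p T - S) x) x; have := CS ((op_poly q T - S') x) x.
have := ler_wpM2r (nrm_ge0 x) (pS x); have := ler_wpM2r (nrm_ge0 x) (qS x).
rewrite !bopB !ipBl -!mulrA -!expr2 !ler_norml => h1 h2 h3 h4.
have {}h3 := le_trans (proj2 (andP h3)) h1.
have [{}h4 _] := andP h4; move: h h3 h4 h1 h2; lra.
Qed.

(** Polynomials within 1 / (n + 1) of f on [a, b] give a Cauchy sequence of operators by
    [op_poly_bound]. *)
Lemma is_cfc_exists f T a b : rsa T -> {within `[a, b], continuous f}%classic ->
  (forall t, spectrum T t%:C -> t \in `[a, b]) -> exists S, is_cfc f T S.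
Proof.
move=> sT cf hT.
have hp (n : nat) : exists p, forall t, t \in `[a, b] -> `|p.[t] - f t| <= n.+1%:R^-1.
  by apply: weierstrass cf _; rewrite invr_gt0.
have [p {}hp] := choice hp.
have small e : 0 < e -> exists N : nat, forall n, (N <= n)%N -> n.+1%:R^-1 <= e.
  move=> e0; exists (Num.bound e^-1) => n hn.
  rewrite -[leRHS]invrK lef_pV2 ?posrE ?invr_gt0//.
  have := archi_boundP (_ : 0 <= e^-1); rewrite invr_ge0 ltW// => /(_ isT)/ltW/le_trans; apply.
  by rewrite ler_nat ltnW.
have [|S hS] := @bop_complete _ H (fun n => op_poly (p n) T).
  move=> e e0; have [|N hN] := small (e / 2); first by rewrite divr_gt0.
  exists N => n m Nn Nm x; rewrite -op_polyB.
  apply: op_poly_bound => //; first exact: ltW.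
  move=> t /hT tab; rewrite hornerD hornerN.
  have := ler_distD (f t) (p n).[t] (p m).[t]; rewrite (distrC (f t)).
  have := le_trans (hp n t tab) (hN n Nn); have := le_trans (hp m t tab) (hN m Nm); lra.
exists S; apply/is_cfcP => e e0; have [N hN] := small e e0; have [N' hN'] := hS e e0.
exists (p (maxn N N')); split=> [t /hT tab|x]; last by apply: hN'; exact: leq_maxr.
by rewrite (le_trans (hp _ _ tab))// hN// leq_maxl.
Qed.

Lemma is_cfc_cfc f T a b : rsa T -> {within `[a, b], continuous f}%classic ->
  (forall t, spectrum T t%:C -> t \in `[a, b]) -> is_cfc f T (cfc f T).
Proof. by move=> sT cf hT; have [S hS] := is_cfc_exists sT cf hT; rewrite (cfcE sT hS). Qed.

End FunctionalCalculus.

(** * Intertwining maps and the functional calculus *)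

Section Intertwining.
Variables (R : realType) (H K : hilbertType R).

(** The identity is algebraic for polynomials, and one polynomial close to f on an interval
    containing both spectra transfers it to f. V may map between different spaces, which covers
    coordinate projections and isometries. *)
Lemma is_cfc_intertwine (V : H -> K) (C : R) (f : R -> R) (T S : bop H) (T' S' : bop K) (a b : R) :
  linear V -> 0 <= C -> (forall x, nrm (V x) <= C * nrm x) -> rsa T -> rsa T' ->
  (forall x, T' (V x) = V (T x)) -> {within `[a, b], continuous f}%classic ->
  (forall t, spectrum T t%:C -> t \in `[a, b]) -> (forall t, spectrum T' t%:C -> t \in `[a, b]) ->
  is_cfc f T S -> is_cfc f T' S' -> forall x, S' (V x) = V (S x).
Proof.
move=> lV C0 hV sT sT' TV cf hT hT' hS hS' x.
have VD u v : V (u + v) = V u + V v by have := lV 1 u v; rewrite !scale1r.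
have V0 : V 0 = 0 by apply: (addrI (V 0)); rewrite -VD !addr0.
have VZ (k : R[i]) u : V (k *: u) = k *: V u.
  by have := lV k u 0; rewrite V0 !addr0.
have pV (p : {poly R}) u : op_poly p T' (V u) = V (op_poly p T u).
  elim/poly_ind : p u => [|p c IH] u.
    by rewrite -(rmorph0 (@polyC _)) !op_polyC !bopZ rmorph0 !scale0r V0.
  rewrite !op_polyD !op_polyM !op_polyX !op_polyC !bopD !bopZ !bopM !bop1 VD VZ.
  by rewrite TV IH.
apply/eqP; rewrite -subr_eq0; apply/eqP/nrm_eq0/le_anti; rewrite nrm_ge0 andbT.
apply: (@le0_small _ _ (2 * (C * nrm x))) => e e0.
have [p hp] := weierstrass cf e0.
have h1 := is_cfc_approx sT hS (ltW e0) (fun t tT => hp t (hT t tT)) x.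
have h2 := is_cfc_approx sT' hS' (ltW e0) (fun t tT => hp t (hT' t tT)) (V x).
have h3 := hV ((op_poly p T - S) x).
move: h1 h2 h3; rewrite !bopB pV VD -[- S x]scaleN1r VZ !scaleN1r => h1 h2 h3.
have h4 := hV x; have h5 := nrm_triangle (S' (V x)) (V (op_poly p T x)) (V (S x)).
rewrite nrm_distC in h2.
nra.
Qed.

End Intertwining.

(** * Hilbert direct sums *)

Section DirectSum.
Variables (R : realType) (H : hilbertType R) (m : nat).

(** An alias that carries its own l2 norm and inner product, declared below. *)
Definition dsum : Type := {ffun 'I_m -> H}.

HB.instance Definition _ := GRing.Lmodule.copy dsum {ffun 'I_m -> H}.

Implicit Types (x y z : dsum).

Lemma dsumD x y j : (x + y : dsum) j = x j + y j. Proof. exact: ffunE. Qed.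
Lemma dsumN x j : (- x : dsum) j = - x j. Proof. exact: ffunE. Qed.
Lemma dsumZ (a : R[i]) x j : (a *: x : dsum) j = a *: x j. Proof. exact: ffunE. Qed.
Lemma dsum0 j : (0 : dsum) j = 0. Proof. exact: ffunE. Qed.
Lemma dsumB x y j : (x - y : dsum) j = x j - y j. Proof. by rewrite dsumD dsumN. Qed.

Definition dnrm x : R := Num.sqrt (\sum_(j < m) nrm (x j) ^+ 2).

Lemma dnrm_sqr x : dnrm x ^+ 2 = \sum_(j < m) nrm (x j) ^+ 2.
Proof. by rewrite sqr_sqrtr// sumr_ge0// => j _; rewrite sqr_ge0. Qed.

Lemma dnrm_ge0 x : 0 <= dnrm x. Proof. exact: sqrtr_ge0. Qed.

Lemma dnrm_comp x j : nrm (x j) <= dnrm x.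
Proof.
rewrite -ler_sqr ?nnegrE ?nrm_ge0 ?dnrm_ge0// dnrm_sqr (bigD1 j)//= lerDl.
by apply: sumr_ge0 => i _; rewrite sqr_ge0.
Qed.

Lemma dnrm_CS x y : \sum_(j < m) ip (x j) (y j) <= dnrm x * dnrm y.
Proof.
rewrite (le_trans (ler_norm _))// -ler_sqr ?nnegrE ?mulr_ge0 ?dnrm_ge0//.
rewrite real_normK ?num_real// exprMn; apply: quad_discr => t.
rewrite !dnrm_sqr mulr_suml -sumrMnl mulr_suml -!big_split sumr_ge0// => j _.
rewrite [leRHS](_ : _ = nrm (x j + t%:C *: y j) ^+ 2) ?sqr_ge0//.
by rewrite -!ipxx !(ipDl, ipDr, ipZl, ipZr) (ipC (y j) (x j)) /=; ring.
Qed.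

Definition dnorm x : R[i] := (dnrm x)%:C.

Lemma dnormD x y : dnorm (x + y) <= dnorm x + dnorm y.
Proof.
rewrite -rmorphD lecR -ler_sqr ?nnegrE ?addr_ge0 ?dnrm_ge0// sqrrD !dnrm_sqr.
rewrite (eq_bigr (fun j => nrm (x j) ^+ 2 + (ip (x j) (y j)) *+ 2 + nrm (y j) ^+ 2)).
  by rewrite !big_split /= lerD2r lerD2l -mulr2n lerMn2r dnrm_CS.
by move=> j _; rewrite dsumD -!ipxx !(ipDl, ipDr) (ipC (y j) (x j)); ring.
Qed.

Lemma dnormZ (a : R[i]) x : dnorm (a *: x) = `|a| * dnorm x.
Proof.
have aE : (complex.Re `|a|)%:C = `|a| by apply/RRe_real/ger0_real.
rewrite -aE -rmorphM; congr (_%:C); rewrite /dnrm.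
have a0 : 0 <= complex.Re `|a| by rewrite -ler0c aE.
rewrite -[X in _ = X * _](ger0_norm a0) -sqrtr_sqr -sqrtrM ?sqr_ge0// mulr_sumr.
by congr Num.sqrt; apply: eq_bigr => j _; rewrite dsumZ nrmZ exprMn.
Qed.

Lemma dnorm_eq0 x : dnorm x = 0 -> x = 0.
Proof.
move=> /(@complexI _ _ 0) x0; apply/ffunP => j; rewrite dsum0; apply/nrm_eq0/le_anti.
by rewrite nrm_ge0 -x0 dnrm_comp.
Qed.

HB.instance Definition _ := Lmodule_isNormed.Build R[i] dsum dnormD dnormZ dnorm_eq0.

Lemma dsum_normE x : `|x| = (dnrm x)%:C. Proof. by []. Qed.

(** A Cauchy filter is Cauchy in each coordinate, and the finitely many coordinate limits assemble
    into a limit. *)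
Lemma dsum_complete (F : set_system dsum) : ProperFilter F -> cauchy F -> cvg F.
Proof.
move=> FF /cauchy_ballP cF.
have posC (e : R[i]) : 0 < e -> e = (complex.Re e)%:C /\ 0 < complex.Re e.
  by case: e => a b; rewrite ltcE /= => /andP[/eqP -> ->]; rewrite complexr0.
have hl (j : 'I_m) : exists l : H, forall e : R, 0 < e -> F (fun x : dsum => nrm (l - x j) <= e).
  have : cauchy ((fun x : dsum => x j) @ F)%classic.
    apply/cauchy_ballP => e e0; rewrite near_map2.
    have := cF e e0; apply: filterS => -[x y]; rewrite -!ball_normE /= => /(le_lt_trans _); apply.
    by rewrite normE dsum_normE lecR -dsumB dnrm_comp.
  move=> /cauchy_cvgP /cvg_ex[l /= /cvgrPdist_le hl]; exists l => e e0.
  have := hl e%:C; rewrite ltcR => /(_ e0); apply: filterS => x.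
  by rewrite normE lecR.
have [l {}hl] := choice hl; apply/cvg_ex; exists [ffun j => l j].
apply/cvgrPdist_le => e /posC[-> e0]; set d := complex.Re e in e0 *.
have m0 : 0 < m.+1%:R :> R by rewrite ltr0n.
(* The m squares of d / (m + 1) add up to at most d^2; using m + 1 covers m = 0. *)
have : F (fun x : dsum => forall j, nrm (l j - x j) <= d / m.+1%:R).
  by apply: filter_forall => j; apply: hl; rewrite divr_gt0.
apply: filterS => x hx; rewrite dsum_normE lecR.
rewrite -ler_sqr ?nnegrE ?dnrm_ge0 ?(ltW e0)// dnrm_sqr.
apply: (@le_trans _ _ (\sum_(j < m) (d / m.+1%:R) ^+ 2)).
  apply: ler_sum => j _; rewrite dsumB ffunE ler_sqr ?nnegrE ?nrm_ge0 ?hx//.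
  by rewrite divr_ge0 ?ltW.
rewrite sumr_const card_ord -[leLHS]mulr_natl.
have -> : m%:R * (d / m.+1%:R) ^+ 2 = d ^+ 2 * (m%:R / m.+1%:R ^+ 2).
  by rewrite expr_div_n; ring.
rewrite ger_pMr ?exprn_gt0//.
rewrite ler_pdivrMr ?exprn_gt0// mul1r -natrX ler_nat.
by rewrite (leq_trans (leqnSn m))// -[leqLHS]expn1 leq_pexp2l.
Qed.

HB.instance Definition _ := Uniform_isComplete.Build dsum dsum_complete.

Definition dinner x y : R[i] := \sum_(j < m) inner (x j) (y j).

Lemma dinner_bilinear : bilinear_for ( *%R : GRing.Scale.law R[i] R[i])
  (Num.conj \; *%R : GRing.Scale.law R[i] R[i]) dinner.
Proof.
split=> u a x y; rewrite /dinner /= mulr_sumr -big_split; apply: eq_bigr => j _.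
  by rewrite dsumD dsumZ innerDl innerZl.
rewrite dsumD dsumZ innerC innerDl innerZl rmorphD rmorphM /=.
by rewrite -!innerC.
Qed.

HB.instance Definition _ := bilinear_isBilinear.Build R[i] dsum dsum R[i]
  *%R (Num.conj \; *%R) dinner dinner_bilinear.

Lemma dinner_hermitian x y : dinner x y = (-1) ^+ false * Num.conj (dinner y x).
Proof.
rewrite expr0 mul1r /dinner rmorph_sum; apply: eq_bigr => j _.
by rewrite innerC.
Qed.

HB.instance Definition _ := isHermitianSesquilinear.Build R[i] dsum false Num.conj
  dinner dinner_hermitian.

Lemma inner_nrm (u : H) : inner u u = (nrm u ^+ 2)%:C.
Proof. by rewrite -sqr_normE normE rmorphXn. Qed.

Lemma dinner_nrm x : dinner x x = (dnrm x ^+ 2)%:C.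
Proof. by rewrite dnrm_sqr rmorph_sum; apply: eq_bigr => j _; rewrite inner_nrm. Qed.

Lemma dinner_gt0 x : x != 0 -> 0 < dinner x x.
Proof.
move=> x0; rewrite dinner_nrm ltcR exprn_gt0// lt_neqAle dnrm_ge0 andbT eq_sym.
by apply: contra x0 => /eqP h; apply/eqP/dnorm_eq0; rewrite /dnorm h.
Qed.

HB.instance Definition _ := isDotProduct.Build R[i] dsum dinner dinner_gt0.

Lemma dsum_sqr_normE x : `|x| ^+ 2 = (dinner : {dot dsum for Num.conj}) x x.
Proof. by rewrite dsum_normE /= dinner_nrm rmorphXn. Qed.

HB.instance Definition _ := isHilbert.Build R dsum dsum_sqr_normE.

Lemma ip_dsum x y : ip x y = \sum_(j < m) ip (x j) (y j).
Proof.
have ReD : {morph (@complex.Re R) : u v / u + v} by case=> ? ? [].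
by rewrite /ip /inner /= (big_morph _ ReD (erefl _)).
Qed.

Lemma nrm_dsum x : nrm x ^+ 2 = \sum_(j < m) nrm (x j) ^+ 2.
Proof. by rewrite -dnrm_sqr /nrm dsum_normE. Qed.

End DirectSum.

(** * The operator Jensen inequality *)

Section Jensen.
Variables (R : realType).

Lemma spectrum_in_pos (H : hilbertType R) (T : bop H) (a : R) : 0 < a -> rsa T ->
  (forall x, a * nrm x ^+ 2 <= ip (T x) x) -> spectrum_in `]0, +oo[ T.
Proof.
move=> a0 sT hT z zT; have [b b0 hb] := ip_bounds T.
have iz : complex.Im z = 0.
  by apply/eqP; apply: contrapT => /negP iz; apply: zT; exact: nonreal_invertible.
have zE : z = (complex.Re z)%:C by rewrite [LHS]complexE iz mulr0 addr0.
exists (complex.Re z) => //; rewrite in_itv /= andbT.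
have bd x : a * nrm x ^+ 2 <= ip (T x) x <= b * nrm x ^+ 2.
  by rewrite hT; have /andP[_ ->] := hb x.
have zT' : spectrum T (complex.Re z)%:C by rewrite -zE.
by have /andP[h _] := spectrum_bounds sT bd zT'; exact: lt_le_trans h.
Qed.

Lemma spectrum_sub (H : hilbertType R) (T : bop H) (a b : R) : rsa T ->
  (forall x, a * nrm x ^+ 2 <= ip (T x) x <= b * nrm x ^+ 2) ->
  forall t, spectrum T t%:C -> t \in `[a, b].
Proof. by move=> sT hT t /(spectrum_bounds sT hT); rewrite in_itv. Qed.

Lemma op_le_half (H : hilbertType R) (S T U : bop H) :
  op_le ((2^-1)%:C *: S + (1 - 2^-1)%:C *: T) U ->
  forall x, ip (S x) x + ip (T x) x <= 2 * ip (U x) x.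
Proof.
move=> /positive_opP[_ h] x; have := h x.
rewrite bopB bopD !bopZ ipBl ipDl !ipZl; lra.
Qed.

(** The common bounds [a] and [b] put the spectra of all operators in the argument into one compact
    interval of positive numbers. [C'] supplies the adjoints of [C]. *)
Lemma operator_jensen_bounds (H : hilbertType R) (m : nat) (C C' X : 'I_m -> bop H)
    (f : R -> R) (a b : R) :
  operator_concave `]0, +oo[ f -> 0 < a -> 0 <= b ->
  (forall j, rsa (X j)) ->
  (forall j x, a * nrm x ^+ 2 <= ip (X j x) x <= b * nrm x ^+ 2) ->
  (forall j x y, ip (C j x) y = ip x (C' j y)) ->
  \sum_(j < m) C' j * C j = 1 ->
  op_le (\sum_(j < m) C' j * cfc f (X j) * C j) (cfc f (\sum_(j < m) C' j * X j * C j)).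
Proof.
move=> [cf concf] a0 b0 sX hX adj sumC.
set T := \sum_(j < m) C' j * X j * C j.
have cfab : {within `[a, b], continuous f}%classic.
  apply: continuous_subspaceW cf => t /=; rewrite !in_itv /= andbT => /andP[h _].
  exact: lt_le_trans h.
have ipS (F : 'I_m -> H) y : ip (\sum_(j < m) F j) y = \sum_(j < m) ip (F j) y.
  exact: ip_suml.
have ipSr (F : 'I_m -> H) y : ip y (\sum_(j < m) F j) = \sum_(j < m) ip y (F j).
  by rewrite ipC ipS; apply: eq_bigr => j _; exact: ipC.
have sum1 x : \sum_(j < m) C' j (C j x) = x.
  by rewrite -[RHS]bop1 -sumC bop_sum.
have adj' j x y : ip (C' j x) y = ip x (C j y) by rewrite ipC -adj ipC.
have sumnrm x : \sum_(j < m) nrm (C j x) ^+ 2 = nrm x ^+ 2.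
  rewrite -ipxx -{2}[x in RHS]sum1 ipSr; apply: eq_bigr => j _.
  by rewrite -adj ipxx.
(* V, Vs, D, W, D' and M are kept opaque: unification would otherwise compare
   their bodies with the unfolding of cfc. *)
have [V VE] : exists V : H -> dsum H m, forall x j, V x j = C j x.
  by exists (fun x => [ffun j => C j x]) => x j; rewrite ffunE.
have [Vs VsE] : exists Vs : dsum H m -> H, forall z, Vs z = \sum_(j < m) C' j (z j).
  by exists (fun z => \sum_(j < m) C' j (z j)).
have linV : linear V.
  by move=> k x y; apply/ffunP => j; rewrite dsumD dsumZ !VE bop_linear.
have linVs : linear Vs.
  move=> k x y; rewrite !VsE scaler_sumr -big_split; apply: eq_bigr => j _.
  by rewrite dsumD dsumZ bop_linear.
have VsV x : Vs (V x) = x.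
  by rewrite VsE -[RHS]sum1; apply: eq_bigr => j _; rewrite VE.
have adjV x z : ip (V x) z = ip x (Vs z).
  by rewrite VsE ip_dsum ipSr; apply: eq_bigr => j _; rewrite VE adj.
have nrmV x : nrm (V x) = nrm x.
  apply/eqP; rewrite -(eqrXn2 (n := 2))// ?nrm_ge0// nrm_dsum -sumnrm.
  by apply/eqP/eq_bigr => j _; rewrite VE.
have nrmVs z : nrm (Vs z) <= nrm z.
  have [->|n0] := eqVneq (nrm (Vs z)) 0; first exact: nrm_ge0.
  have n1 : 0 < nrm (Vs z) by rewrite lt_neqAle eq_sym n0 nrm_ge0.
  rewrite -(ler_pM2l n1) -expr2 -ipxx -adjV (le_trans (ler_norm _))//.
  by rewrite (le_trans (CS _ _))// nrmV.
have Xbd j x : nrm (X j x) <= b * nrm x.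
  apply: pos_opbound => // y; have /andP[h1 ->] := hX j y; rewrite andbT.
  by apply: le_trans h1; rewrite mulr_ge0 ?sqr_ge0// ltW.
pose Df (z : dsum H m) : dsum H m := [ffun j => X j (z j)].
have [D DE] : exists D : bop (dsum H m), forall z, D z = Df z.
  apply: (@mkbop _ _ _ b) => [k x y|z].
    by apply/ffunP => j; rewrite dsumD dsumZ !ffunE bop_linear.
  rewrite -ler_sqr ?nnegrE ?mulr_ge0 ?nrm_ge0// exprMn !nrm_dsum mulr_sumr.
  by apply: ler_sum => j _; rewrite ffunE -exprMn ler_sqr ?nnegrE ?mulr_ge0 ?nrm_ge0.
(* The reflection that fixes the range of V. *)
have [W WE] : exists W : bop (dsum H m), forall z, W z = V (Vs z) *+ 2 - z.
  apply: (@mkbop _ _ _ 3) => [k x y|z].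
    by rewrite linVs linV scalerBr -scalerMnr mulrnDl opprD addrACA.
  rewrite (le_trans (nrmB _ _))// mulr2n.
  have := nrmD (V (Vs z)) (V (Vs z)); rewrite !nrmV; have := nrmVs z; lra.
have WV x : W (V x) = V x by rewrite WE VsV mulr2n addrK.
have sW : rsa W.
  move=> x y; rewrite !WE mulr2n mulr2n !(ipDl, ipDr, ipNl, ipNr) adjV.
  by rewrite (ipC x (V _)) adjV (ipC (Vs y)).
have WW z : W (W z) = z.
  by rewrite [W z]WE bop_sub mulr2n bop_add !WV WE mulr2n opprB addrC subrK.
have nrmW z : nrm (W z) ^+ 2 = nrm z ^+ 2 by rewrite -!ipxx sW WW.
have sD : rsa D.
  move=> x y; rewrite !ip_dsum; apply: eq_bigr => j _.
  by rewrite !DE !ffunE sX.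
have hD z : a * nrm z ^+ 2 <= ip (D z) z <= b * nrm z ^+ 2.
  rewrite ip_dsum !nrm_dsum !mulr_sumr; apply/andP; split; apply: ler_sum => j _;
    by rewrite DE ffunE; have /andP[] := hX j (z j).
have [D' D'E] : exists D', D' = W * D * W by exists (W * D * W).
have sD' : rsa D' by move=> x y; rewrite D'E !bopM sW sD sW.
have hD' z : a * nrm z ^+ 2 <= ip (D' z) z <= b * nrm z ^+ 2.
  by rewrite D'E !bopM sW -nrmW hD.
have [M ME] : exists M, M = (2^-1)%:C *: D + (1 - 2^-1)%:C *: D'.
  by exists ((2^-1)%:C *: D + (1 - 2^-1)%:C *: D').
have sM : rsa M by rewrite ME; apply: rsaD; exact: rsaZ.
have hM z : a * nrm z ^+ 2 <= ip (M z) z <= b * nrm z ^+ 2.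
  rewrite ME bopD !bopZ ipDl !ipZl; have := hD z; have := hD' z.
  move=> /andP[h1 h2] /andP[h3 h4]; lra.
(* Since W V = V, W D W V = W D V = 2 V T - D V, and the average with D V is V T. *)
have MV x : M (V x) = V (T x).
  have TE : T x = Vs (D (V x)).
    by rewrite /T bop_sum VsE; apply: eq_bigr => j _; rewrite DE ffunE VE.
  rewrite ME bopD !bopZ D'E !bopM WV WE -TE.
  have -> : 1 - 2^-1 = 2^-1 :> R by field.
  rewrite -scalerDr addrC subrK -[V (T x) *+ 2]scaler_nat scalerA.
  by rewrite -(rmorph_nat (real_complex R)) -rmorphM mulVf ?pnatr_eq0// scale1r.
have sT : rsa T.
  move=> x y; rewrite /T !bop_sum ipS ipSr; apply: eq_bigr => j _.
  by rewrite !bopM adj' sX adj.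
have hT x : a * nrm x ^+ 2 <= ip (T x) x <= b * nrm x ^+ 2.
  rewrite /T bop_sum ipS -sumnrm !mulr_sumr; apply/andP; split; apply: ler_sum => j _;
    by rewrite !bopM adj'; have /andP[] := hX j (C j x).
have cD := is_cfc_cfc sD cfab (spectrum_sub sD hD).
have cD' := is_cfc_cfc sD' cfab (spectrum_sub sD' hD').
have cM := is_cfc_cfc sM cfab (spectrum_sub sM hM).
have cT := is_cfc_cfc sT cfab (spectrum_sub sT hT).
have cX j := is_cfc_cfc (sX j) cfab (spectrum_sub (sX j) (hX j)).
(* The j-th coordinate projection intertwines D with [X j], so f(D) is diagonal with entries f(X
   j). *)
have fX j (z : dsum H m) : cfc f (X j) (z j) = cfc f D z j.
  have lp : linear (fun z : dsum H m => z j) by move=> k x y; rewrite dsumD dsumZ.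
  apply: (is_cfc_intertwine lp ler01 _ sD (sX j) _ cfab (spectrum_sub sD hD)
    (spectrum_sub (sX j) (hX j)) cD (cX j)) => x; last by rewrite DE ffunE.
  by rewrite mul1r; exact: dnrm_comp.
have fW z : cfc f D' (W z) = W (cfc f D z).
  have [k k0 hk] := bop_bounded W.
  apply: (is_cfc_intertwine (bop_linear W) (ltW k0) hk sD sD' _ cfab (spectrum_sub sD hD)
    (spectrum_sub sD' hD') cD cD') => x.
  by rewrite D'E !bopM WW.
have fV x : cfc f M (V x) = V (cfc f T x).
  apply: (is_cfc_intertwine linV ler01 _ sT sM MV cfab (spectrum_sub sT hT)
    (spectrum_sub sM hM) cT cM) => u.
  by rewrite nrmV mul1r.
apply/op_leP => [||x].
- move=> x y; rewrite !bop_sum ipS ipSr; apply: eq_bigr => j _.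
  by rewrite !bopM adj' (is_cfc_rsa (sX j) (cX j)) adj.
- exact: is_cfc_rsa cT.
have lower (N : bop (dsum H m)) : (forall z, a * nrm z ^+ 2 <= ip (N z) z <= b * nrm z ^+ 2) ->
    forall z, a * nrm z ^+ 2 <= ip (N z) z by move=> h z; have /andP[] := h z.
have half : 0 <= (2^-1 : R) <= 1 by lra.
have key : op_le ((2^-1)%:C *: cfc f D + (1 - 2^-1)%:C *: cfc f D') (cfc f M).
  rewrite ME; apply: concf half; [exact/self_adjointP|exact/self_adjointP|..].
    exact: spectrum_in_pos a0 sD (lower _ hD).
  exact: spectrum_in_pos a0 sD' (lower _ hD').
have e1 : ip (cfc f M (V x)) (V x) = ip (cfc f T x) x by rewrite fV adjV VsV.
(* On the range of V, f(D) and f(W D W) have the same quadratic form, as W is symmetric and fixes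
   that range. *)
have e2 (P Q : bop (dsum H m)) : (forall z, Q (W z) = W (P z)) ->
    ip (Q (V x)) (V x) = ip (P (V x)) (V x).
  by move=> h; have := h (V x); rewrite WV => ->; rewrite sW WV.
have e3 : ip (cfc f D (V x)) (V x) = ip ((\sum_(j < m) C' j * cfc f (X j) * C j) x) x.
  rewrite bop_sum ipS ip_dsum; apply: eq_bigr => j _.
  by rewrite -fX !bopM adj' !VE.
have fin (p q r s t : R) : p + q <= 2 * r -> r = t -> q = p -> p = s -> s <= t.
  by clear; lra.
exact: fin (op_le_half key (V x)) e1 (e2 _ _ fW) e3.
Qed.

End Jensen.

(** * Powers of strictly positive operators *)

Section PowerCalculus.
Variable R : realType.

(** Weighted arithmetic-geometric mean: apply ln x <= x - 1 at t / u with weight p and at 1 / u with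
    weight 1 - p; the right-hand sides cancel by the choice of u. *)
Lemma powR_le_affine (t p : R) : 0 < t -> 0 <= p <= 1 -> t `^ p <= (1 - p) + p * t.
Proof.
move=> t0 /andP[p0 p1]; set u := 1 - p + p * t.
have u0 : 0 < u.
  by rewrite /u; have [->|pn1] := eqVneq p 1; [lra|have : p < 1 by rewrite lt_neqAle pn1]; nra.
have ln_le (x : R) : 0 < x -> ln x <= x - 1.
  by move=> x0; have := @le_ln1Dx _ (x - 1); rewrite (addrC 1) subrK; apply; lra.
rewrite -ler_ln ?posrE ?powR_gt0// ln_powR.
have h1 := ln_le _ (divr_gt0 t0 u0); have h2 := ln_le _ (divr_gt0 ltr01 u0).
move: h1 h2; rewrite !ln_div ?posrE// ln1 => h1 h2.
have h3 : p * (t / u - 1) + (1 - p) * (1 / u - 1) = 0 by rewrite /u; field; rewrite -/u; lra.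
have := ler_wpM2l p0 h1; have : 0 <= 1 - p by lra.
move=> /ler_wpM2l /(_ _ _ h2); lra.
Qed.

(** The previous inequality at the point t^p with exponent 1 / p, multiplied by p. *)
Lemma powR_ge_affine (t p : R) : 0 < t -> 1 <= p -> (1 - p) + p * t <= t `^ p.
Proof.
move=> t0 p1; have p0 : 0 < p by lra.
have pV : 0 <= p^-1 <= 1 by rewrite invr_ge0 (ltW p0) invf_le1.
have h := powR_le_affine (powR_gt0 p t0) pV.
have tE : (t `^ p) `^ p^-1 = t by rewrite -powRrM mulfV ?gt_eqF// powRr1// ltW.
rewrite tE in h; have := ler_wpM2l (ltW p0) h.
have -> : p * (1 - p^-1 + p^-1 * t `^ p) = p - 1 + t `^ p by field; lra.
lra.
Qed.

Lemma powR_within_continuous (q a b : R) : 0 < a ->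
  {within `[a, b], continuous (fun t => t `^ q)}%classic.
Proof.
move=> a0; apply: continuous_in_subspaceT => t; rewrite inE /= in_itv /= => /andP[at0 _].
apply/differentiable_continuous/derivable1_diffP/derivable_powR.
by rewrite in_itv /= andbT; exact: lt_le_trans at0.
Qed.

Variable H : hilbertType R.
Implicit Types (x y : H) (S T : bop H) (f g h : R -> R).

Lemma strictly_positiveP T : strictly_positive T <->
  rsa T /\ exists2 a, 0 < a & forall x, a * nrm x ^+ 2 <= ip (T x) x.
Proof.
split=> [[/positive_opP[sT pT] iT]|[sT [a a0 hT]]].
  by split=> //; exact: pos_invertible_coercive.
split; last exact: coercive_invertible hT.
apply/positive_opP; split=> // x; apply: le_trans (hT x).
by rewrite mulr_ge0 ?sqr_ge0// ltW.
Qed.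

Lemma spd_rsa T : strictly_positive T -> rsa T.
Proof. by move=> /strictly_positiveP[]. Qed.

Lemma spd_bounds T : strictly_positive T ->
  exists a b, [/\ 0 < a, 0 < b & forall x, a * nrm x ^+ 2 <= ip (T x) x <= b * nrm x ^+ 2].
Proof.
move=> /strictly_positiveP[sT [a a0 hT]]; have [b b0 hb] := ip_bounds T.
by exists a, b; split=> // x; rewrite hT; have /andP[_ ->] := hb x.
Qed.

Lemma spd_spectrum_gt0 T t : strictly_positive T -> spectrum T t%:C -> 0 < t.
Proof.
move=> hT; have [a [b [a0 _ hab]]] := spd_bounds hT.
by move=> /(spectrum_bounds (spd_rsa hT) hab) /andP[h _]; exact: lt_le_trans h.
Qed.

Lemma spd_cfc f T : {within `]0, +oo[, continuous f}%classic -> strictly_positive T ->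
  is_cfc f T (cfc f T).
Proof.
move=> cf hT; have [a [b [a0 _ hab]]] := spd_bounds hT.
apply: is_cfc_cfc (spd_rsa hT) _ (spectrum_sub (spd_rsa hT) hab).
apply: continuous_subspaceW cf => t /=; rewrite !in_itv /= andbT => /andP[h _].
exact: lt_le_trans h.
Qed.

Lemma op_powP q T : strictly_positive T -> is_cfc (fun t => t `^ q) T (op_pow T q).
Proof.
move=> hT; have [a [b [a0 _ hab]]] := spd_bounds hT.
apply: is_cfc_cfc (spd_rsa hT) _ (spectrum_sub (spd_rsa hT) hab).
exact: powR_within_continuous.
Qed.

Lemma op_pow_rsa q T : strictly_positive T -> rsa (op_pow T q).
Proof. by move=> hT; exact: is_cfc_rsa (spd_rsa hT) (op_powP q hT). Qed.

(** Turns a scalar identity on the spectrum into an operator identity, by uniqueness of the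
    calculus. *)
Lemma is_cfc_mulE f g h T S S' U : rsa T -> is_cfc f T S -> is_cfc g T S' -> is_cfc h T U ->
  (forall t, spectrum T t%:C -> f t * g t = h t) -> S * S' = U.
Proof.
move=> sT hf hg hh fgh; apply: (is_cfc_uniq sT _ hh).
exact: is_cfc_ext fgh (is_cfc_mul sT hf hg).
Qed.

Lemma op_powD q r T : strictly_positive T -> op_pow T q * op_pow T r = op_pow T (q + r).
Proof.
move=> hT; apply: (is_cfc_mulE (spd_rsa hT) (op_powP q hT) (op_powP r hT) (op_powP _ hT)).
move=> t /(spd_spectrum_gt0 hT) t0; rewrite powRD//.
by apply/implyP => _; rewrite gt_eqF.
Qed.

Lemma op_pow0 T : strictly_positive T -> op_pow T 0 = 1.
Proof.
move=> hT; apply: is_cfc_uniq (spd_rsa hT) (op_powP 0 hT) _.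
have := is_cfc_affine T 1 0; rewrite rmorph0 scale0r addr0 scale1r.
by apply: is_cfc_ext => t _; rewrite powRr0 mul0r addr0.
Qed.

Lemma op_pow1 T : strictly_positive T -> op_pow T 1 = T.
Proof.
move=> hT; apply: is_cfc_uniq (spd_rsa hT) (op_powP 1 hT) _.
apply: is_cfc_ext (is_cfc_id T) => t /(spd_spectrum_gt0 hT) t0.
by rewrite powRr1// ltW.
Qed.

Lemma rsa_conj S T : rsa S -> rsa T -> rsa (S * T * S).
Proof. by move=> sS sT x y; rewrite !bopM sS sT sS. Qed.

Lemma ip_conj S T x : rsa S -> ip ((S * T * S) x) x = ip (T (S x)) (S x).
Proof. by move=> sS; rewrite !bopM sS. Qed.

Variables A B : bop H.
Hypotheses (hA : strictly_positive A) (hB : strictly_positive B).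

Let r := op_pow A 2^-1.
Let s := op_pow A (- 2^-1).
Let X := op_conj A B.

Lemma op_pow_sqrt_sqr : r * r = A.
Proof. by rewrite /r op_powD// (_ : 2^-1 + 2^-1 = 1) ?op_pow1//; field. Qed.

Lemma op_pow_sqrtK : r * s = 1.
Proof. by rewrite /r /s op_powD// subrr op_pow0. Qed.

Lemma op_pow_sqrtVK : s * r = 1.
Proof. by rewrite /r /s op_powD// addNr op_pow0. Qed.

Lemma op_conjK : r * X * r = B.
Proof.
rewrite /X /op_conj -/s !mulrA op_pow_sqrtK mul1r -mulrA op_pow_sqrtVK.
exact: mulr1.
Qed.

(** The form of X at x is that of B at s x, and |x| = |r s x| <= k |s x| keeps it coercive. *)
Lemma op_conj_spd : strictly_positive X.
Proof.
have sr := op_pow_rsa 2^-1 hA; have ss := op_pow_rsa (- 2^-1) hA.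
apply/strictly_positiveP; split; first exact: rsa_conj (spd_rsa hB).
have [c [d [c0 _ hc]]] := spd_bounds hB; have [k k0 hk] := bop_bounded r.
exists (c / k ^+ 2); first by rewrite divr_gt0 ?exprn_gt0.
move=> x; rewrite ip_conj// -/s; have /andP[h _] := hc (s x); apply: le_trans h.
rewrite -mulrA ler_pM2l// mulrC ler_pdivrMr ?exprn_gt0// mulrC -exprMn.
rewrite ler_sqr ?nnegrE ?mulr_ge0 ?nrm_ge0 ?(ltW k0)//.
by have := hk (s x); rewrite -bopM op_pow_sqrtK bop1.
Qed.

Lemma natural_pow_rsa q : rsa (natural_pow q A B).
Proof. by apply: rsa_conj; exact: op_pow_rsa op_conj_spd || exact: op_pow_rsa hA. Qed.

(** At y = r x the forms of 1 and X become those of A and B, so tangent lines in X become affine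
    combinations of A and B. *)
Lemma affine_conj p x : ip (((1 - p)%:C *: (1 : bop H) + p%:C *: X) (r x)) (r x) =
  (1 - p) * ip (A x) x + p * ip (B x) x.
Proof.
have sr := op_pow_rsa 2^-1 hA.
have -> : ip (A x) x = ip ((r * r) x) x by rewrite op_pow_sqrt_sqr.
have -> : ip (B x) x = ip ((r * X * r) x) x by rewrite op_conjK.
by rewrite ip_conj// bopM sr bopD !bopZ bop1 ipDl !ipZl.
Qed.

Lemma natural_pow_le p x : 0 <= p <= 1 ->
  ip (natural_pow p A B x) x <= (1 - p) * ip (A x) x + p * ip (B x) x.
Proof.
move=> p01; rewrite -affine_conj ip_conj; last exact: op_pow_rsa.
apply: (is_cfc_le (spd_rsa op_conj_spd) (op_powP p op_conj_spd) (is_cfc_affine _ _ _)).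
move=> t /(spd_spectrum_gt0 op_conj_spd) t0; exact: powR_le_affine.
Qed.

Lemma natural_pow_ge p x : 1 <= p ->
  (1 - p) * ip (A x) x + p * ip (B x) x <= ip (natural_pow p A B x) x.
Proof.
move=> p1; rewrite -affine_conj ip_conj; last exact: op_pow_rsa.
apply: (is_cfc_le (spd_rsa op_conj_spd) (is_cfc_affine _ _ _) (op_powP p op_conj_spd)).
move=> t /(spd_spectrum_gt0 op_conj_spd) t0; exact: powR_ge_affine.
Qed.

Variable f : R -> R.
Hypothesis cf : {within `]0, +oo[, continuous f}%classic.

Lemma entropy_rsa q : rsa (entropy f q A B).
Proof.
rewrite /entropy -[_ * _ * cfc _ _]mulrA; apply: rsa_conj; first exact: op_pow_rsa.
exact: is_cfc_rsa (spd_rsa op_conj_spd) (is_cfc_mul (spd_rsa op_conj_spd)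
  (op_powP q op_conj_spd) (spd_cfc cf op_conj_spd)).
Qed.

Lemma entropy_ge0 q x : (forall t, 0 < t -> 0 <= f t) -> 0 <= ip (entropy f q A B x) x.
Proof.
move=> f0; rewrite /entropy -[_ * _ * cfc _ _]mulrA ip_conj; last exact: op_pow_rsa.
have sX := spd_rsa op_conj_spd; have := is_cfc_affine X 0 0.
rewrite rmorph0 !scale0r addr0 => c0.
have := is_cfc_le sX c0 (is_cfc_mul sX (op_powP q op_conj_spd) (spd_cfc cf op_conj_spd)).
rewrite -/r -/X => h; have := h _ (r x); rewrite bop0 ip0l; apply => t.
move=> /(spd_spectrum_gt0 op_conj_spd) t0; by rewrite mul0r addr0 mulr_ge0 ?powR_ge0// f0.
Qed.

(** Half of the power p goes into each of the two weights, so that [C' p * C p] restores the full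
    power. *)
Let C p := op_pow X (p / 2) * r.
Let C' p := r * op_pow X (p / 2).

Lemma conj_adj p x y : ip (C p x) y = ip x (C' p y).
Proof.
have h (P Q : bop H) : rsa P -> rsa Q -> ip ((P * Q) x) y = ip x ((Q * P) y).
  by move=> sP sQ; rewrite !bopM sP sQ.
exact: h (op_pow_rsa _ op_conj_spd) (op_pow_rsa _ hA).
Qed.

Let mul_conj (P Q S U : bop H) : Q * S * Q = U -> P * Q * S * (Q * P) = P * U * P.
Proof. by move=> <-; rewrite !mulrA. Qed.

Lemma conj_sum p : C' p * C p = natural_pow p A B.
Proof.
have e : op_pow X (p / 2) * 1 * op_pow X (p / 2) = op_pow X p.
  by rewrite mulr1 op_powD; [rewrite -splitr|exact: op_conj_spd].
by have := mul_conj r e; rewrite mulr1.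
Qed.

Lemma conj_conj p : C' p * X * C p = natural_pow (p + 1) A B.
Proof.
apply: mul_conj; have hX := op_conj_spd.
rewrite -[Y in _ * Y * _](op_pow1 hX) op_powD// op_powD//.
by congr op_pow; field.
Qed.

(** Powers of X and f(X) belong to the calculus of the same operator, so the two half powers around
    f(X) merge. *)
Lemma conj_cfc p : C' p * cfc f X * C p = entropy f p A B.
Proof.
have sX := spd_rsa op_conj_spd; have cP q := op_powP q op_conj_spd.
have fX := spd_cfc cf op_conj_spd.
rewrite /entropy -[_ * _ * cfc _ _]mulrA; apply: mul_conj.
apply: (is_cfc_mulE sX (is_cfc_mul sX (cP (p / 2)) fX) (cP (p / 2))
  (is_cfc_mul sX (cP p) fX)) => t /(spd_spectrum_gt0 op_conj_spd) t0.
by rewrite mulrAC -powRD -?splitr//; apply/implyP => _; rewrite gt_eqF.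
Qed.

End PowerCalculus.

(** * Operator Shannon entropy *)

Section Entropy.
Variables (R : realType) (H : hilbertType R).
Implicit Types (x y : H) (S T U : bop H) (f : R -> R).

Theorem operator_jensen (m : nat) (C C' X : 'I_m -> bop H) f :
  operator_concave `]0, +oo[ f ->
  (forall j, strictly_positive (X j)) ->
  (forall j x y, ip (C j x) y = ip x (C' j y)) ->
  \sum_(j < m) C' j * C j = 1 ->
  op_le (\sum_(j < m) C' j * cfc f (X j) * C j) (cfc f (\sum_(j < m) C' j * X j * C j)).
Proof.
move=> cf hX adj sumC.
have [a ha] := choice (fun j => spd_bounds (hX j)).
have [b hab] := choice ha.
have a0 j : 0 < a j by have [] := hab j.
have b0 j : 0 < b j by have [] := hab j.
have sum_ge (u : 'I_m -> R) j : (forall i, 0 < u i) -> u j <= \sum_(i < m) u i.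
  by move=> u0; rewrite (bigD1 j)//= lerDl sumr_ge0// => i _; exact: ltW.
have s0 (u : 'I_m -> R) : (forall i, 0 < u i) -> 0 <= \sum_(i < m) u i.
  by move=> u0; rewrite sumr_ge0// => i _; exact: ltW.
have aV0 j : 0 < (a j)^-1 by rewrite invr_gt0.
(* The inverse of this number is a lower bound below every a j; the summand 1 covers the empty
   family. *)
have c0 : 0 < 1 + \sum_(j < m) (a j)^-1 by rewrite ltr_pwDl// s0.
apply: (@operator_jensen_bounds _ _ _ _ _ _ _
  (1 + \sum_(j < m) (a j)^-1)^-1 (\sum_(j < m) b j)) => //.
- by rewrite invr_gt0.
- exact: s0.
- by move=> j; exact: spd_rsa.
move=> j x; have [_ _ /(_ x)/andP[h1 h2]] := hab j; apply/andP; split.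
  apply: le_trans h1; rewrite ler_wpM2r ?sqr_ge0// -[leRHS]invrK lef_pV2 ?posrE//.
  by have := sum_ge _ j aV0; lra.
by apply: le_trans h2 _; rewrite ler_wpM2r ?sqr_ge0// sum_ge.
Qed.

Lemma rsa_defect T : rsa T -> rsa (1 - T).
Proof. by move=> sT; apply: rsaB => //; exact: rsa1. Qed.

Lemma ip_defect T x : ip ((1 - T) x) x = nrm x ^+ 2 - ip (T x) x.
Proof. by rewrite bopB bop1 ipBl ipxx. Qed.

(** Zero may lie in the spectrum, so the square root comes from the calculus on [0, b] and not from
    [op_pow]. *)
Lemma sqrt_defect T : rsa T -> (forall x, 0 <= ip (T x) x) -> exists2 S, rsa S & S * S = T.
Proof.
move=> sT pT; have [b b0 hb] := ip_bounds T.
have hT x : 0 * nrm x ^+ 2 <= ip (T x) x <= b * nrm x ^+ 2.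
  by rewrite mul0r pT; have /andP[_ ->] := hb x.
have cs : {within `[0, b], continuous (@Num.sqrt R)}%classic.
  exact/continuous_subspaceT/sqrt_continuous.
have hS := is_cfc_cfc sT cs (spectrum_sub sT hT).
exists (cfc Num.sqrt T); first exact: is_cfc_rsa hS.
apply: (is_cfc_mulE sT hS hS (is_cfc_id T)) => t.
by move=> /(spectrum_bounds sT hT) /andP[t0 _]; rewrite -expr2 sqr_sqrtr.
Qed.

Lemma scalar_spd (t : R) : 0 < t -> strictly_positive (t%:C *: (1 : bop H)).
Proof.
move=> t0; apply/strictly_positiveP; split; first by apply: rsaZ; exact: rsa1.
by exists t => // x; rewrite bopZ bop1 ipZl ipxx.
Qed.

(** The spectrum of a scalar operator contains at most t, and there f agrees with the constant
    polynomial f t. *)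
Lemma cfc_scalar f (t : R) : cfc f (t%:C *: (1 : bop H)) = (f t)%:C *: (1 : bop H).
Proof.
have st : rsa (t%:C *: (1 : bop H)) by apply: rsaZ; exact: rsa1.
apply: cfcE => //; rewrite -(op_polyC (f t) (t%:C *: (1 : bop H))).
apply: is_cfc_ext (is_cfc_op_poly _ _) => u ut; rewrite hornerC; congr f.
have h x : t * nrm x ^+ 2 <= ip ((t%:C *: (1 : bop H)) x) x <= t * nrm x ^+ 2.
  by rewrite bopZ bop1 ipZl ipxx lexx.
by apply: le_anti; exact: (spectrum_bounds st h ut).
Qed.

(* The defect 1 - \sum_j C' j * C j is filled by one more weight, its square root,
   attached to the scalar operator t. *)
Lemma operator_jensen_defect (n : nat) (C C' X : 'I_n -> bop H) f (t : R) :
  operator_concave `]0, +oo[ f -> 0 < t ->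
  (forall j, strictly_positive (X j)) ->
  (forall j x y, ip (C j x) y = ip x (C' j y)) ->
  (forall x, ip ((\sum_(j < n) C' j * C j) x) x <= nrm x ^+ 2) ->
  let D := 1 - \sum_(j < n) C' j * C j in
  op_le ((f t)%:C *: D + \sum_(j < n) C' j * cfc f (X j) * C j)
        (cfc f (t%:C *: D + \sum_(j < n) C' j * X j * C j)).
Proof.
move=> cf t0 hX adj le1 D.
have adj' j x y : ip (C' j x) y = ip x (C j y) by rewrite ipC -adj ipC.
have sD : rsa D.
  apply: rsa_defect => x y; rewrite !bop_sum ip_suml ipC ip_suml; apply: eq_bigr => j _.
  by rewrite !bopM !adj' ipC.
have [S sS SS] : exists2 S, rsa S & S * S = D.
  by apply: sqrt_defect => // x; rewrite ip_defect subr_ge0.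
pose ext (F : 'I_n -> bop H) F0 (j : 'I_n.+1) := oapp F F0 (unlift ord0 j).
have ext0 F F0 : ext F F0 ord0 = F0 by rewrite /ext unlift_none.
have extS F F0 j : ext F F0 (lift ord0 j) = F j by rewrite /ext liftK.
have scal (u : R) : S * (u%:C *: (1 : bop H)) * S = u%:C *: D.
  by rewrite -bop_scaleAr mulr1 -bop_scaleAl SS.
pose X' := ext X (t%:C *: (1 : bop H)).
have e1 : \sum_(j < n.+1) ext C' S j * ext C S j = 1.
  rewrite big_ord_recl !ext0 SS -[RHS](subrK (\sum_(j < n) C' j * C j)); congr (_ + _).
  by apply: eq_bigr => j _; rewrite !extS.
have e2 : \sum_(j < n.+1) ext C' S j * cfc f (X' j) * ext C S j =
    (f t)%:C *: D + \sum_(j < n) C' j * cfc f (X j) * C j.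
  rewrite big_ord_recl /X' !ext0 cfc_scalar scal; congr (_ + _).
  by apply: eq_bigr => j _; rewrite !extS.
have e3 : \sum_(j < n.+1) ext C' S j * X' j * ext C S j =
    t%:C *: D + \sum_(j < n) C' j * X j * C j.
  rewrite big_ord_recl /X' !ext0 scal; congr (_ + _).
  by apply: eq_bigr => j _; rewrite !extS.
rewrite -e2 -e3; apply: operator_jensen => //.
- by move=> j; rewrite /X' /ext; case: unliftP => [i|] _ /=; [exact: hX|exact: scalar_spd].
- by move=> j x y; rewrite /ext; case: unliftP => [i|] _ /=; [exact: adj|exact: sS].
Qed.

Lemma op_le_trivial S T : (forall x, x = 0) -> op_le S T.
Proof.
move=> h0; apply/positive_opP; split=> [x y|x]; last by rewrite (h0 x) bop_at0 ip0l.
by rewrite (h0 x) (h0 y) bop_at0.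
Qed.

(** The infimum of the form lies in the spectrum, hence is positive, so T is strictly positive and
    f(T) can be compared with the zero function of T. *)
Lemma cfc_ge0 f T x0 : x0 != 0 -> {within `]0, +oo[, continuous f}%classic ->
  (forall t, 0 < t -> 0 <= f t) -> rsa T -> spectrum_in `]0, +oo[ T ->
  rsa (cfc f T) /\ forall x, 0 <= ip (cfc f T x) x.
Proof.
move=> x00 cf f0 sT hT; have [m [mT hm]] := spectrum_inf x00 sT.
have [u] := hT _ mT; rewrite in_itv /= andbT => u0 /(@complexI _ _ _) mu.
have spdT : strictly_positive T by apply/strictly_positiveP; split=> //; exists m => //; rewrite mu.
have cT := spd_cfc cf spdT; split; first exact: is_cfc_rsa cT.
move=> x; have := is_cfc_affine T 0 0; rewrite rmorph0 !scale0r addr0 => c0.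
have := is_cfc_le sT c0 cT _ x; rewrite bop0 ip0l; apply => t /(spd_spectrum_gt0 spdT) t0.
by rewrite mul0r addr0 f0.
Qed.

End Entropy.

(** * The two Shannon entropy inequalities *)

Theorem theorem2p3 (R : realType) (H : hilbertType R) (n : nat)
    (A B : 'I_n -> bop H) (f : R -> R)
    (hA : forall j, strictly_positive (A j))
    (hB : forall j, strictly_positive (B j))
    (sumA : \sum_(j < n) A j = 1) (sumB : \sum_(j < n) B j = 1)
    (f_ge0 : forall t : R, 0 < t -> 0 <= f t)
    (f_mono : operator_monotone `]0, +oo[ f)
    (f_conc : operator_concave `]0, +oo[ f) :
  (forall p t0 : R, 0 <= p <= 1 -> 0 < t0 ->
     op_le (shannon_entropy f p A B)
       (cfc f (\sum_(j < n) natural_pow (p + 1) (A j) (B j)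
               + t0%:C *: (1 - \sum_(j < n) natural_pow p (A j) (B j)))
        - (f t0)%:C *: (1 - \sum_(j < n) natural_pow p (A j) (B j)))) /\
  (forall p t0 : R, 2 <= p <= 3 -> 0 < t0 ->
     (* f is only defined on ]0, +oo[, so its argument must have its spectrum
        there; unlike in the first part, this does not hold for every t0. *)
     spectrum_in `]0, +oo[
       (\sum_(j < n) natural_pow (p - 1) (A j) (B j)
        + t0%:C *: (1 - \sum_(j < n) natural_pow p (A j) (B j))) ->
     op_le
       (- cfc f (\sum_(j < n) natural_pow (p - 1) (A j) (B j)
                 + t0%:C *: (1 - \sum_(j < n) natural_pow p (A j) (B j)))
        + (f t0)%:C *: (1 - \sum_(j < n) natural_pow p (A j) (B j)))
       (shannon_entropy f p A B)).
Proof.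
have cf := f_conc.1.
have nat_rsa q : rsa (\sum_(j < n) natural_pow q (A j) (B j)).
  by apply: rsa_sum => j; exact: natural_pow_rsa.
(* Both families sum to the identity, so the tangent-line bounds on the [natural_pow] terms sum to
   bounds by the identity. *)
have affine p x : \sum_(j < n) ((1 - p) * ip (A j x) x + p * ip (B j x) x) = nrm x ^+ 2.
  rewrite big_split -!mulr_sumr -!ip_suml -!bop_sum sumA sumB bop1 ipxx /=; ring.
split=> p t0 hp t0_gt0.
- pose X j := op_conj (A j) (B j).
  pose C j := op_pow (X j) (p / 2) * op_pow (A j) 2^-1.
  pose C' j := op_pow (A j) 2^-1 * op_pow (X j) (p / 2).
  have eK : \sum_(j < n) C' j * C j = \sum_(j < n) natural_pow p (A j) (B j).
    by apply: eq_bigr => j _; exact: conj_sum.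
  have eX : \sum_(j < n) C' j * X j * C j = \sum_(j < n) natural_pow (p + 1) (A j) (B j).
    by apply: eq_bigr => j _; exact: conj_conj.
  have eS : \sum_(j < n) C' j * cfc f (X j) * C j = shannon_entropy f p A B.
    by apply: eq_bigr => j _; exact: conj_cfc.
  have := @operator_jensen_defect R H n C C' X f t0 f_conc t0_gt0 _ _ _.
  rewrite eK eX eS /op_le => h.
  (* Moves f(t0)(I - K) to the side of the entropy, where Jensen's inequality with defect has it. *)
  rewrite -addrA -opprD [_ + t0%:C *: _]addrC; apply: h.
  + by move=> j; exact: op_conj_spd.
  + by move=> j x y; exact: conj_adj.
  + move=> x; rewrite bop_sum ip_suml -(affine p); apply: ler_sum => j _.
    exact: natural_pow_le.
(* The zero space is treated apart because [cfc_ge0] needs a nonzero vector. *)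
- move=> hY; have [[x0 x00]|h0] := pselect (exists x : H, x != 0); last first.
    apply: op_le_trivial => x; apply/eqP; apply: contrapT => /negP x0.
    by apply: h0; exists x.
  have p1 : 1 <= p by lra.
  have sY := rsaD (nat_rsa (p - 1)) (rsaZ t0 (rsa_defect (nat_rsa p))).
  have [sF F0] := cfc_ge0 x00 cf f_ge0 sY hY.
  apply/op_leP => [||x].
  + by apply: rsaD; [exact: rsaN|apply: rsaZ; exact: rsa_defect].
  + by apply: rsa_sum => j; exact: entropy_rsa.
  rewrite bopD bopN bopZ ipDl ipNl ipZl ip_defect /shannon_entropy !bop_sum !ip_suml.
  have S0 : 0 <= \sum_(j < n) ip (entropy f p (A j) (B j) x) x.
    by apply: sumr_ge0 => j _; exact: entropy_ge0.
  have K1 : nrm x ^+ 2 <= \sum_(j < n) ip (natural_pow p (A j) (B j) x) x.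
    rewrite -(affine p); apply: ler_sum => j _; exact: natural_pow_ge.
  have := F0 x; have := f_ge0 _ t0_gt0; nra.
Qed.
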